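(* Let $A\to B$ be a map of $\mathcal{O}$-Tambara functors and $W$ a $B$-module. For every $h\in\mathrm{Hom}_B(\Omega_{A|B},W)$ the composition $h\circ\delta$ is an $A$-derivation. Furthermore, all derivations are of this form: the map $$\mathrm{Hom}_B(\Omega_{A|B},W)\to\mathrm{Der}_A(B,W),\qquad h\mapsto h\circ\delta,$$ is an isomorphism.
   Context: Let $G$ be a finite group. An indexing system $\mathcal{O}$ assigns to each subgroup $H\le G$ a class $\mathcal{O}(G/H)$ of finite $H$-sets, closed under isomorphism, restriction, conjugation and disjoint union, containing all trivial $H$-sets, closed under finite limits, and closed under self-induction: if $H/K\in\mathcal{O}(G/H)$ and $T\in\mathcal{O}(G/K)$ then $H\times_K T\in\mathcal{O}(G/H)$. A map $f:X\to Y$ of finite $G$-sets is admissible if $G_{f(x)}/G_x\in\mathcal{O}(G/G_{f(x)})$ for all $x\in X$. An $\mathcal{O}$-Tambara functor is a commutative Green functor $R$ for $G$ (a commutative monoid in Mackey functors under the box product $\boxtimes$; transfers $T_f$, restrictions $R_f$) together with multiplicative norm maps $N_f:R(X)\to R(Y)$ for each admissible $f:X\to Y$, functorial in $f$, equal to multiplication for fold maps, and satisfying the double coset formulas and Tambara reciprocity. Modules over $R$ are modules over the underlying Green functor; $\boxtimes_A$ is the relative box product, which is the coproduct of $A$-algebras ($\mathcal{O}$-Tambara functors under $A$). An ($\mathcal{O}$-genuine) $A$-derivation $d:B\to W$ is a map of Mackey functors such that the composite $A\to B\to W$ is zero and, for every admissible $f:X\to Y$ (including fold maps) and $s\in B(X)$,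 $$d(N_f(s))=T_f\big(N_{\pi_2}R_{\pi_1}(s)\cdot d(s)\big),$$ where $\pi_1,\pi_2:(X\times_Y X)\setminus\Delta(X)\to X$ are the projections. $\mathrm{Der}_A(B,W)$ is the set of these. Let $I=\ker(\mu:B\boxtimes_A B\to B)$, where $\mu$ is the codiagonal (multiplication). $I^{>1}$ is the smallest ideal (kernel of a map of $\mathcal{O}$-Tambara functors) of $B\boxtimes_A B$ containing all $N_f(i)$ with $f:X\to Y$ admissible and 2-surjective (every fiber has at least 2 elements) and $i\in I(X)$. The module of Kähler differentials is $\Omega_{A|B}=I/I^{>1}$, a $B$-module, and $\delta:B\to\Omega_{A|B}$ is $\delta(b)=\overline{1\otimes b-b\otimes1}$. *)

(* Defs.v *)
From HB Require Import structures.
From mathcomp Require Import all_boot all_algebra all_fingroup.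
From mathcomp Require Import boolp.

Set Implicit Arguments.
Unset Strict Implicit.
Unset Printing Implicit Defensive.

Import GRing.Theory.
Local Open Scope ring_scope.

(* Finite G-sets are taken with right actions, following the library; they are
   identified with left ones through g . x = x . g^-1.  In particular the
   orbit G/H is the set of right cosets of H, and G_x is 'C[x | _]. *)
Record gset (gT : finGroupType) := GSet {
  gcar :> finType;
  gact : {action gT &-> gcar}
}.

Arguments gact {gT} g : rename.

Record gmap (gT : finGroupType) (X Y : gset gT) := GMap {
  gfun :> X -> Y;
  gmapP : forall x a, gfun (gact X x a) = gact Y (gfun x) a
}.

Section GSets.
Variable gT : finGroupType.
Implicit Types X Y Z E : gset gT.

Lemma gact1 X x : gact X x 1%g = x. Proof. exact: act1. Qed.
Lemma gactM X x a b : gact X x (a * b)%g = gact X (gact X x a) b.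
Proof. exact: actM. Qed.

Lemma gmap_eq X Y (f g : gmap X Y) : f =1 g -> f = g.
Proof.
case: f g => [f fP] [g gP] /= /funext fg; subst g.
by rewrite (Prop_irrelevance fP gP).
Qed.

Definition gid X : gmap X X := @GMap _ X X id (fun _ _ => erefl).

Lemma gcomp_subproof X Y Z (g : gmap Y Z) (f : gmap X Y) x a :
  g (f (gact X x a)) = gact Z (g (f x)) a.
Proof. by rewrite !gmapP. Qed.
Definition gcomp X Y Z (g : gmap Y Z) (f : gmap X Y) : gmap X Z :=
  GMap (gcomp_subproof g f).

Definition giso X Y := exists f : gmap X Y, bijective f.

Definition gstab X (x : X) : {group gT} := 'C[x | gact X]%G.

Definition gset_triv (T : finType) : gset gT :=
  @GSet gT T (@TotalAction gT T (fun x _ => x) (fun _ => erefl)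
                (fun _ _ _ => erefl)).

Section Sum.
Variables X Y : gset gT.
Definition sum_act (z : X + Y) a : X + Y :=
  match z with inl x => inl (gact X x a) | inr y => inr (gact Y y a) end.
Lemma sum_act1 : sum_act^~ 1%g =1 id.
Proof. by case=> z /=; rewrite gact1. Qed.
Lemma sum_actM z : act_morph sum_act z.
Proof. by case: z => z a b /=; rewrite gactM. Qed.
Definition gset_sum : gset gT := GSet (TotalAction sum_act1 sum_actM).
Definition ginl : gmap X gset_sum := @GMap _ X gset_sum inl (fun _ _ => erefl).
Definition ginr : gmap Y gset_sum := @GMap _ Y gset_sum inr (fun _ _ => erefl).
End Sum.

Definition gfold_fun X (z : X + X) : X :=
  match z with inl x => x | inr x => x end.
Lemma gfold_subproof X (z : gset_sum X X) a :
  gfold_fun (gact (gset_sum X X) z a) = gact X (gfold_fun z) a.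
Proof. by case: z. Qed.
Definition gfold X : gmap (gset_sum X X) X := GMap (@gfold_subproof X).

Section Prod.
Variables X Y : gset gT.
Definition prod_act (z : X * Y) a : X * Y := (gact X z.1 a, gact Y z.2 a).
Lemma prod_act1 : prod_act^~ 1%g =1 id.
Proof. by case=> x y; rewrite /prod_act /= !gact1. Qed.
Lemma prod_actM z : act_morph prod_act z.
Proof. by case: z => x y a b; rewrite /prod_act /= !gactM. Qed.
Definition gset_prod : gset gT := GSet (TotalAction prod_act1 prod_actM).
End Prod.

Section Sub.
Variables (X : gset gT) (P : pred X).
Hypothesis Pact : forall x a, P x -> P (gact X x a).
Definition sub_act (x : {x | P x}) a : {x | P x} :=
  exist _ (gact X (val x) a) (Pact a (valP x)).
Lemma sub_act1 : sub_act^~ 1%g =1 id.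
Proof. by move=> x; apply: val_inj; rewrite /= gact1. Qed.
Lemma sub_actM x : act_morph sub_act x.
Proof. by move=> a b; apply: val_inj; rewrite /= gactM. Qed.
Definition gset_sub : gset gT := GSet (TotalAction sub_act1 sub_actM).
End Sub.

Section Equalizer.
Variables (X Y : gset gT) (f g : gmap X Y).
Lemma geq_subproof x a : f x == g x -> f (gact X x a) == g (gact X x a).
Proof. by move=> /eqP e; rewrite !gmapP e. Qed.
Definition gset_eq : gset gT := gset_sub geq_subproof.
End Equalizer.

Section Pullback.
Variables (X Y Z : gset gT) (g : gmap Z Y) (f : gmap X Y).
Lemma gpb_subproof (w : gset_prod Z X) a : g w.1 == f w.2 ->
  g (gact (gset_prod Z X) w a).1 == f (gact (gset_prod Z X) w a).2.
Proof. by move=> /eqP e; rewrite !gmapP e. Qed.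
Definition gpb : gset gT := gset_sub gpb_subproof.
Definition gpb1 : gmap gpb Z :=
  @GMap _ gpb Z (fun w => (val w).1) (fun _ _ => erefl).
Definition gpb2 : gmap gpb X :=
  @GMap _ gpb X (fun w => (val w).2) (fun _ _ => erefl).
End Pullback.

Section OffDiagonal.
Variables (X Y : gset gT) (f : gmap X Y).
Lemma goffdiag_subproof (w : gset_prod X X) a :
  (f w.1 == f w.2) && (w.1 != w.2) ->
  let w' := gact (gset_prod X X) w a in
  (f w'.1 == f w'.2) && (w'.1 != w'.2).
Proof.
move=> /andP[/eqP e n] /=; rewrite !gmapP e eqxx /=.
by apply: contra n => /eqP /act_inj /eqP.
Qed.
Definition goffdiag : gset gT := gset_sub goffdiag_subproof.
Definition gpi1 : gmap goffdiag X :=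
  @GMap _ goffdiag X (fun w => (val w).1) (fun _ _ => erefl).
Definition gpi2 : gmap goffdiag X :=
  @GMap _ goffdiag X (fun w => (val w).2) (fun _ _ => erefl).
End OffDiagonal.

Definition is_pullback X Y Z P (g : gmap Z Y) (f : gmap X Y)
    (f' : gmap P Z) (g' : gmap P X) : Prop :=
  (forall w, g (f' w) = f (g' w)) /\
  (forall z x, g z = f x -> exists! w, f' w = z /\ g' w = x).

Lemma gpbP X Y Z (g : gmap Z Y) (f : gmap X Y) :
  is_pullback g f (gpb1 g f) (gpb2 g f).
Proof.
split=> [[w /= /eqP]//|z x e].
have h : g (z, x).1 == f (z, x).2 by apply/eqP.
exists (exist _ (z, x) h); split=> // -[[z' x'] h'] /= [ez ex].
by apply: val_inj; rewrite /= ez ex.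
Qed.

(* Exponential diagram exhibiting q : P -> Y as the dependent product of
   p : E -> X along f : the point t of P stands for the section of p over the
   fibre of f at q t that sends x to e x', where x' is the point of
   X' = X x_Y P over (x, t). *)
Definition is_exponential X Y E X' P (f : gmap X Y) (p : gmap E X)
    (e : gmap X' E) (f' : gmap X' P) (q : gmap P Y) : Prop :=
  is_pullback q f f' (gcomp p e) /\
  (forall (y : Y) (s : forall x, f x = y -> E),
    (forall x hx, p (s x hx) = x) ->
    exists! t, q t = y /\
      forall x' (hx : f (p (e x')) = y), f' x' = t -> e x' = s (p (e x')) hx).

Definition two_surjective X Y (f : gmap X Y) : Prop :=
  forall y, (2 <= #|[set x | f x == y]|)%N.

End GSets.

Section Pull.
Variables (aT bT : finGroupType) (f : aT -> bT).
Hypothesis fM : {morph f : a b / (a * b)%g}.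
Variable X : gset bT.
Definition pull_act (x : X) a := gact X x (f a).
Lemma pull_act1 : pull_act^~ 1%g =1 id.
Proof.
have f1 : f 1%g = 1%g by apply: (mulgI (f 1%g)); rewrite -fM !mulg1.
by move=> x; rewrite /pull_act f1 gact1.
Qed.
Lemma pull_actM x : act_morph pull_act x.
Proof. by move=> a b; rewrite /pull_act fM gactM. Qed.
Definition gset_pull : gset aT := GSet (TotalAction pull_act1 pull_actM).
End Pull.

Section HSets.
Variable gT : finGroupType.
Implicit Types H K : {group gT}.

Definition hset H := gset (subg_of H).

Lemma incl_subproof H K (sKH : K \subset H) :
  {morph (fun k : subg_of K => subg H (sgval k)) : a b / (a * b)%g}.
Proof.
have mem (k : subg_of K) : sgval k \in H by rewrite (subsetP sKH) ?subgP.
by move=> a b; apply: subg_inj; rewrite /= !subgK ?groupM ?mem.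
Qed.
Definition hres H K (sKH : K \subset H) (X : hset H) : hset K :=
  gset_pull (incl_subproof sKH) X.

Lemma conj_subproof H (g : gT) :
  {morph (fun k : subg_of (H :^ g)%G => subg H (sgval k ^ g^-1)%g) :
     a b / (a * b)%g}.
Proof.
have mem (k : subg_of (H :^ g)%G) : (sgval k ^ g^-1)%g \in H.
  by rewrite -mem_conjg; apply: subgP.
move=> a b; apply: subg_inj; rewrite /= conjMg.
rewrite (@subgK _ _ _ (mem a)) (@subgK _ _ _ (mem b)) subgK //.
by apply: groupM; apply: mem.
Qed.
Definition hconj H (g : gT) (X : hset H) : hset (H :^ g)%G :=
  gset_pull (@conj_subproof H g) X.

Section Orbit.
Variables K H : {group gT}.
Definition orbit_car : finType := {S : {set gT} | S \in rcosets K H}.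
Lemma orbit_subproof (S : orbit_car) (h : subg_of H) :
  (val S :* sgval h)%g \in rcosets K H.
Proof.
case: S => S /= /rcosetsP[x xH ->]; rewrite -rcosetM.
by rewrite mem_rcosets (subsetP (mulG_subr _ _)) // groupM ?subgP.
Qed.
Definition orbit_act (S : orbit_car) (h : subg_of H) : orbit_car :=
  exist (fun S => S \in rcosets K H) _ (orbit_subproof S h).
Lemma orbit_act1 : orbit_act^~ 1%g =1 id.
Proof. by move=> S; apply: val_inj; rewrite /= rcoset1. Qed.
Lemma orbit_actM S : act_morph orbit_act S.
Proof. by move=> a b; apply: val_inj; rewrite /= rcosetM. Qed.
Definition horbit : hset H := GSet (TotalAction orbit_act1 orbit_actM).
End Orbit.

(* H x_K T for right actions: pairs (t, h) up to (t, h) ~ (t k, k^-1 h) *)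
Section Induction.
Variables (H K : {group gT}) (T : hset K).
Definition ind_class (t : T) (h : gT) : {set T * gT} :=
  [set (gact T t k, ((sgval k)^-1 * h)%g) | k : subg_of K].
Definition ind_car : finType :=
  {S : {set T * gT} |
    [exists t : T, exists h : subg_of H, S == ind_class t (sgval h)]}.
Definition ind_tr (S : {set T * gT}) (a : gT) : {set T * gT} :=
  [set (p.1, (p.2 * a)%g) | p in S].
Lemma ind_tr_class t h a : ind_tr (ind_class t h) a = ind_class t (h * a)%g.
Proof.
rewrite /ind_tr /ind_class -imset_comp; apply: eq_imset => k /=.
by rewrite mulgA.
Qed.
Lemma ind_subproof (S : ind_car) (a : subg_of H) :
  [exists t : T, exists h : subg_of H,
     ind_tr (val S) (sgval a) == ind_class t (sgval h)].
Proof.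
case: S => S /= /existsP[t /existsP[h /eqP->]].
by apply/existsP; exists t; apply/existsP; exists (h * a)%g; rewrite ind_tr_class.
Qed.
Definition ind_act (S : ind_car) (a : subg_of H) : ind_car :=
  exist (fun S => [exists t : T, exists h : subg_of H,
    S == ind_class t (sgval h)]) _ (ind_subproof S a).
Lemma ind_act1 : ind_act^~ 1%g =1 id.
Proof.
case=> S h; apply: val_inj => /=; case/existsP: h => t /existsP[h /eqP->].
by rewrite ind_tr_class mulg1.
Qed.
Lemma ind_actM S : act_morph ind_act S.
Proof.
case: S => S h a b; apply: val_inj => /=.
by case/existsP: h => t /existsP[h /eqP->]; rewrite !ind_tr_class mulgA.
Qed.
Definition hind : hset H := GSet (TotalAction ind_act1 ind_actM).
End Induction.

End HSets.

Arguments hind {gT} H {K} T.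

Record indexing_system (gT : finGroupType) := IndexingSystem {
  isys :> forall H : {group gT}, hset H -> Prop;
  isys_iso : forall (H : {group gT}) (X Y : hset H),
    giso X Y -> isys X -> isys Y;
  isys_res : forall (H K : {group gT}) (sKH : K \subset H) (X : hset H),
    isys X -> isys (hres sKH X);
  isys_conj : forall (H : {group gT}) (g : gT) (X : hset H),
    isys X -> isys (hconj g X);
  isys_sum : forall (H : {group gT}) (X Y : hset H),
    isys X -> isys Y -> isys (gset_sum X Y);
  isys_triv : forall (H : {group gT}) (T : finType),
    isys (gset_triv (subg_of H) T);
  (* finite limits: the terminal object is trivial, so that binary products
     and equalizers suffice *)
  isys_prod : forall (H : {group gT}) (X Y : hset H),
    isys X -> isys Y -> isys (gset_prod X Y);
  isys_eq : forall (H : {group gT}) (X Y : hset H) (f g : gmap X Y),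
    isys X -> isys Y -> isys (gset_eq f g);
  isys_ind : forall (H K : {group gT}) (T : hset K), K \subset H ->
    isys (horbit K H) -> isys T -> isys (hind H T)
}.

Definition admissible (gT : finGroupType) (O : indexing_system gT)
    (X Y : gset gT) (f : gmap X Y) : Prop :=
  forall x : X, O _ (horbit (gstab x) (gstab (f x))).

Section AdmissibleBaseChange.
Variables (gT : finGroupType) (O : indexing_system gT).

Lemma isys_sub (H : {group gT}) (X S : hset H) (i : gmap S X) :
  injective i -> O H X -> O H S.
Proof.
move=> iI OX; pose U := gset_triv (subg_of H) unit.
pose Q := gset_sum X U.
have OQ : O H Q by apply: isys_sum OX (isys_triv _ _ _).
have inE x a : (gact X x a \in codom i) = (x \in codom i).
  apply/codomP/codomP=> -[s e].
    exists (gact S s a^-1%g); rewrite gmapP -e -gactM mulgV gact1 //.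
  by exists (gact S s a); rewrite gmapP e.
pose u0 (x : X) : X + unit := if x \in codom i then inl x else inr tt.
have u0P x a : u0 (gact X x a) = gact Q (u0 x) a.
  by rewrite /u0 inE; case: ifP.
pose u : gmap X Q := @GMap _ X Q u0 u0P.
apply: isys_iso (isys_eq (ginl X U) u OX OQ).
have eqP0 (w : gset_eq (ginl X U) u) : val w \in codom i.
  by case: w => w /=; rewrite /u0; case: ifP.
have hP s : ginl X U (i s) == u (i s) by rewrite /= /u0 codom_f.
pose j (s : S) : gset_eq (ginl X U) u := exist _ (i s) (hP s).
pose k w := iinv (eqP0 w).
have jk : cancel k j by move=> w; apply: val_inj; rewrite /= f_iinv.
have kj : cancel j k by move=> s; apply: iI; rewrite f_iinv.
have kP w a : k (gact _ w a) = gact S (k w) a.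
  by apply: (can_inj kj); rewrite jk; apply: val_inj; rewrite /= gmapP f_iinv.
by exists (@GMap _ (gset_eq (ginl X U) u) S k kP); exists j.
Qed.

Lemma admissible_pullback (X Y Z P : gset gT) (g : gmap Z Y) (f : gmap X Y)
    (f' : gmap P Z) (g' : gmap P X) :
  injective (fun w => (f' w, g' w)) -> (forall w, g (f' w) = f (g' w)) ->
  admissible O f -> admissible O f'.
Proof.
move=> inj comm Of w.
set H := gstab (f' w); set K := gstab w.
have := Of (g' w); set H1 := gstab (f (g' w)); set K1 := gstab (g' w) => OHK.
have inS (V : gset gT) (v : V) a : (a \in gstab v) = (gact V v a == v).
  by apply/astab1P/eqP.
have sH : H \subset H1.
  apply/subsetP=> a; rewrite !inS => /eqP e.
  by rewrite -comm -gmapP e.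
have KE : K :=: (H :&: K1)%g.
  apply/setP=> a; rewrite in_setI !inS; apply/eqP/andP=> [e|[/eqP e1 /eqP e2]].
    by rewrite -!gmapP e !eqxx.
  by apply: inj; rewrite /= !gmapP e1 e2.
have sK : K \subset H by rewrite KE subsetIl.
have sK1 : K1 \subset H1.
  by apply/subsetP=> a; rewrite !inS => /eqP e; rewrite -gmapP e.
have := isys_res sH OHK.
have memP (S : horbit K H) : ((K1 : {set gT}) * val S)%g \in rcosets K1 H1.
  case: S => S /= /rcosetsP[x xH ->].
  rewrite mulgA (mulGSid _) ?mem_rcosets ?(subsetP (mulG_subr _ _)) //.
    by rewrite (subsetP sH).
  by rewrite KE subsetIr.
pose i (S : horbit K H) : hres sH (horbit K1 H1) :=
  exist (fun S => S \in rcosets K1 H1) _ (memP S).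
have iP S a : i (gact _ S a) = gact (hres sH (horbit K1 H1)) (i S) a.
  apply: val_inj; rewrite /= subgK ?mulgA //.
  by rewrite (subsetP sH) ?subgP.
apply: (@isys_sub _ _ _ (GMap iP)).
move=> S T /(congr1 val) /= e; apply: val_inj; move: e.
case: S T => S /= /rcosetsP[x xH ->] [T /= /rcosetsP[y yH ->]].
rewrite !mulgA !(mulGSid _) ?KE ?subsetIr // => e.
apply/rcoset_eqP; rewrite mem_rcoset in_setI groupM ?groupV //=.
by rewrite -mem_rcoset -e rcoset_refl.
Qed.

Lemma admissible_pi2 (X Y : gset gT) (f : gmap X Y) :
  admissible O f -> admissible O (gpi2 f).
Proof.
apply: (@admissible_pullback _ _ _ _ f f (gpi2 f) (gpi1 f)) => [w w' [e2 e1]|].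
  by apply: val_inj; rewrite [LHS]surjective_pairing [RHS]surjective_pairing e1 e2.
by case=> w /= /andP[/eqP].
Qed.
End AdmissibleBaseChange.

Definition mk_additive (U V : zmodType) (f : U -> V) (fB : zmod_morphism f) :
  {additive U -> V} := HB.pack f (GRing.isZmodMorphism.Build U V f fB).

Lemma additive_eq (U V : zmodType) (f g : {additive U -> V}) : f =1 g -> f = g.
Proof.
case: f g => [f [[fP]]] [g [[gP]]] /= /funext fg.
have {}fg : f = g by [].
by subst g; rewrite (Prop_irrelevance fP gP).
Qed.

Section Mackey.
Variable gT : finGroupType.
Implicit Types X Y Z : gset gT.

Record is_mackey (M : gset gT -> zmodType)
    (res : forall X Y, gmap X Y -> {additive M Y -> M X})
    (tr : forall X Y, gmap X Y -> {additive M X -> M Y}) : Prop := IsMackey {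
  mk_res_id : forall X x, res X X (gid X) x = x;
  mk_res_comp : forall X Y Z (g : gmap Y Z) (f : gmap X Y) x,
    res X Z (gcomp g f) x = res X Y f (res Y Z g x);
  mk_tr_id : forall X x, tr X X (gid X) x = x;
  mk_tr_comp : forall X Y Z (g : gmap Y Z) (f : gmap X Y) x,
    tr X Z (gcomp g f) x = tr Y Z g (tr X Y f x);
  mk_dc : forall X Y Z P (g : gmap Z Y) (f : gmap X Y)
    (f' : gmap P Z) (g' : gmap P X), is_pullback g f f' g' ->
    forall x, res Z Y g (tr X Y f x) = tr P Z f' (res P X g' x);
  mk_empty : forall X, (X -> False) -> forall x : M X, x = 0;
  mk_sum : forall X Y (x : M X) (y : M Y),
    exists! z : M (gset_sum X Y),
      res _ _ (ginl X Y) z = x /\ res _ _ (ginr X Y) z = y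
}.

Record mackey := Mackey {
  mobj :> gset gT -> zmodType;
  mres : forall X Y, gmap X Y -> {additive mobj Y -> mobj X};
  mtr : forall X Y, gmap X Y -> {additive mobj X -> mobj Y};
  mackeyP : is_mackey mres mtr
}.

Record mackey_map (M N : mackey) := MackeyMap {
  mmap :> forall X, {additive M X -> N X};
  mmap_res : forall X Y (f : gmap X Y) x,
    mmap X (mres M f x) = mres N f (mmap Y x);
  mmap_tr : forall X Y (f : gmap X Y) x,
    mmap Y (mtr M f x) = mtr N f (mmap X x)
}.

Lemma mackey_map_eq (M N : mackey) (h k : mackey_map M N) :
  (forall X x, h X x = k X x) -> h = k.
Proof.
case: h k => [h h1 h2] [k k1 k2] /= hk.
have {}hk : h = k by apply: functional_extensionality_dep => X; apply: additive_eq (hk X).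
by subst k; rewrite (Prop_irrelevance h1 k1) (Prop_irrelevance h2 k2).
Qed.

Section Comp.
Variables (M N P : mackey) (k : mackey_map N P) (h : mackey_map M N).
Lemma mcomp_additive X : zmod_morphism (fun x => k X (h X x)).
Proof. by move=> x y; rewrite !raddfB. Qed.
Lemma mcomp_res X Y (f : gmap X Y) x :
  k X (h X (mres M f x)) = mres P f (k Y (h Y x)).
Proof. by rewrite !mmap_res. Qed.
Lemma mcomp_tr X Y (f : gmap X Y) x :
  k Y (h Y (mtr M f x)) = mtr P f (k X (h X x)).
Proof. by rewrite !mmap_tr. Qed.
Definition mcomp : mackey_map M P :=
  @MackeyMap M P (fun X => mk_additive (@mcomp_additive X)) mcomp_res mcomp_tr.
End Comp.

Section MapSum.
Variables (M N : mackey) (h k : mackey_map M N).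
Lemma mmap_add_res X Y (f : gmap X Y) x :
  h X (mres M f x) + k X (mres M f x) = mres N f (h Y x + k Y x).
Proof. by rewrite !mmap_res raddfD. Qed.
Lemma mmap_add_tr X Y (f : gmap X Y) x :
  h Y (mtr M f x) + k Y (mtr M f x) = mtr N f (h X x + k X x).
Proof. by rewrite !mmap_tr raddfD. Qed.
Definition mmap_add : mackey_map M N :=
  @MackeyMap M N (fun X => h X \+ k X : {additive M X -> N X})
    mmap_add_res mmap_add_tr.
End MapSum.

Lemma mackey_split (M : mackey) X Y (z : M (gset_sum X Y)) :
  z = mtr M (ginl X Y) (mres M (ginl X Y) z)
    + mtr M (ginr X Y) (mres M (ginr X Y) z).
Proof.
have [rid rcomp tid tcomp dc empty sum] := mackeyP M.
have ll : is_pullback (ginl X Y) (ginl X Y) (gid X) (gid X).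
  by split=> // x x' [<-]; exists x; split=> // w [<-].
have rr : is_pullback (ginr X Y) (ginr X Y) (gid Y) (gid Y).
  split=> // x x' [<-]; by exists x; split=> // w [<-].
have lr x : mres M (ginl X Y) (mtr M (ginr X Y) x) = 0.
  rewrite (dc _ _ _ _ _ _ _ _ (gpbP _ _)) [X in mtr _ _ X]empty ?raddf0 //.
  by case=> w /=.
have rl x : mres M (ginr X Y) (mtr M (ginl X Y) x) = 0.
  rewrite (dc _ _ _ _ _ _ _ _ (gpbP _ _)) [X in mtr _ _ X]empty ?raddf0 //.
  by case=> w /=.
have [w [_ uniq]] := sum X Y (mres M (ginl X Y) z) (mres M (ginr X Y) z).
rewrite -{1}(uniq z) //; apply: uniq; rewrite !raddfD /= lr rl.
rewrite (dc _ _ _ _ _ _ _ _ ll) (dc _ _ _ _ _ _ _ _ rr).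
by rewrite !rid !tid addr0 add0r.
Qed.

Record submackey (M : mackey) := SubMackey {
  sm :> forall X, M X -> Prop;
  sm0 : forall X, sm (0 : M X);
  smB : forall X (x y : M X), sm x -> sm y -> sm (x - y);
  sm_res : forall X Y (f : gmap X Y) y, sm y -> sm (mres M f y);
  sm_tr : forall X Y (f : gmap X Y) x, sm x -> sm (mtr M f x)
}.

Section SubMackeyTheory.
Variables (M : mackey) (S : submackey M).

Lemma smN X (x : M X) : S X x -> S X (- x).
Proof. by move=> Sx; rewrite -sub0r; apply: smB Sx; apply: sm0. Qed.
Lemma smD X (x y : M X) : S X x -> S X y -> S X (x + y).
Proof. by move=> Sx Sy; rewrite -[y]opprK; apply/smB/smN. Qed.

Lemma sm_sum X Y (z : M (gset_sum X Y)) :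
  S _ (mres M (ginl X Y) z) -> S _ (mres M (ginr X Y) z) -> S _ z.
Proof. by move=> Sl Sr; rewrite (mackey_split z); apply: smD; apply: sm_tr. Qed.

Definition sm_pred X : pred (M X) := fun x => `[< S X x >].

Lemma sm_zmod_closed X : zmod_closed (@sm_pred X).
Proof.
split=> [|x y /asboolP Sx /asboolP Sy]; first exact/asboolP/sm0.
exact/asboolP/smB.
Qed.
HB.instance Definition _ X :=
  GRing.isZmodClosed.Build (M X) (@sm_pred X) (sm_zmod_closed X).

Definition sm_closed X : zmodClosed (M X) := GRing.ZmodClosed.clone (M X) (@sm_pred X) _.

Section Obj.
Variable X : gset gT.
Record sub_car := SubCar { sub_val :> M X; sub_valP : sm_pred sub_val }.
HB.instance Definition _ := [isSub for sub_val].
HB.instance Definition _ := [Choice of sub_car by <:].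
HB.instance Definition _ := [SubChoice_isSubZmodule of sub_car by <:].

Lemma sub_inP (x : M X) : S X x -> sm_pred x. Proof. by move/asboolP. Qed.
Definition sub_in (x : M X) (Sx : S X x) : sub_car := SubCar (sub_inP Sx).
Lemma sub_out (x : sub_car) : S X (val x).
Proof. by case: x => x /= /asboolP. Qed.

Definition quot_car := @Quotient.quot (M X) (sm_closed X).
HB.instance Definition _ := GRing.Zmodule.on quot_car.
Lemma quot_pi_subproof :
  zmod_morphism (fun x => (\pi_(@Quotient.quot (M X) (sm_closed X)) x)%qT : quot_car).
Proof. by move=> x y; rewrite !piE. Qed.
Definition quot_pi : {additive M X -> quot_car} :=
  mk_additive quot_pi_subproof.
Lemma quot_piP x y : quot_pi x = quot_pi y <-> S X (x - y).
Proof.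
split=> [/eqP|Sxy]; first by rewrite -Quotient.idealrBE => /asboolP.
by apply/eqP; rewrite -Quotient.idealrBE; apply/asboolP.
Qed.
Lemma quot_pi_surj (q : quot_car) : exists x, quot_pi x = q.
Proof. by exists (generic_quotient.repr q); apply: reprK. Qed.
End Obj.
End SubMackeyTheory.
End Mackey.

Section SubQuotMackey.
Variables (gT : finGroupType) (M : mackey gT) (S : submackey M).
Implicit Types X Y Z : gset gT.

Section SubLift.
Variables (X Y : gset gT) (h : {additive M Y -> M X}).
Hypothesis hS : forall y, S Y y -> S X (h y).
Definition sub_lift_fun (y : sub_car S Y) : sub_car S X :=
  sub_in (hS (sub_out y)).
Lemma sub_lift_subproof : zmod_morphism sub_lift_fun.
Proof. by move=> x y; apply: val_inj; rewrite /= !raddfB. Qed.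
Definition sub_lift : {additive sub_car S Y -> sub_car S X} :=
  mk_additive sub_lift_subproof.

Definition quot_lift_fun (q : quot_car S Y) : quot_car S X :=
  quot_pi S X (h (generic_quotient.repr q)).
Lemma quot_lift_funE y : quot_lift_fun (quot_pi S Y y) = quot_pi S X (h y).
Proof.
apply/quot_piP; rewrite -raddfB; apply: hS.
by apply/quot_piP; rewrite [LHS]reprK.
Qed.
Lemma quot_lift_subproof : zmod_morphism quot_lift_fun.
Proof.
move=> p q; have [x <-] := quot_pi_surj p; have [y <-] := quot_pi_surj q.
by rewrite -raddfB !quot_lift_funE !raddfB.
Qed.
Definition quot_lift : {additive quot_car S Y -> quot_car S X} :=
  mk_additive quot_lift_subproof.
Lemma quot_liftE y : quot_lift (quot_pi S Y y) = quot_pi S X (h y).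
Proof. exact: quot_lift_funE. Qed.
End SubLift.

Definition sub_res X Y (f : gmap X Y) := sub_lift (sm_res (s:=S) f).
Definition sub_tr X Y (f : gmap X Y) := sub_lift (sm_tr (s:=S) f).

Lemma sub_is_mackey :
  @is_mackey gT (fun X => sub_car S X : zmodType) sub_res sub_tr.
Proof.
have [rid rcomp tid tcomp dc empty sum] := mackeyP M.
split=> [X x|X Y Z g f x|X x|X Y Z g f x|X Y Z P g f f' g' pb x|X X0 x|X Y x y].
- by apply: val_inj; rewrite /= rid.
- by apply: val_inj; rewrite /= rcomp.
- by apply: val_inj; rewrite /= tid.
- by apply: val_inj; rewrite /= tcomp.
- by apply: val_inj; rewrite /= (dc _ _ _ _ _ _ _ _ pb).
- by apply: val_inj; apply: empty.
have [z [[zx zy] uniq]] := sum X Y (val x) (val y).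
have Sz : S _ z by apply: sm_sum; rewrite ?zx ?zy; apply: sub_out.
exists (sub_in Sz); split; first by split; apply: val_inj => /=; rewrite ?zx ?zy.
move=> w [wx wy]; apply: val_inj; apply: uniq.
by rewrite -wx -wy.
Qed.
Definition sub_mackey : mackey gT := Mackey sub_is_mackey.

Definition quot_res X Y (f : gmap X Y) := quot_lift (sm_res (s:=S) f).
Definition quot_tr X Y (f : gmap X Y) := quot_lift (sm_tr (s:=S) f).

Lemma quot_resE X Y (f : gmap X Y) y :
  quot_res f (quot_pi S Y y) = quot_pi S X (mres M f y).
Proof. exact: quot_liftE. Qed.
Lemma quot_trE X Y (f : gmap X Y) x :
  quot_tr f (quot_pi S X x) = quot_pi S Y (mtr M f x).
Proof. exact: quot_liftE. Qed.

Lemma quot_is_mackey :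
  @is_mackey gT (fun X => quot_car S X : zmodType) quot_res quot_tr.
Proof.
have [rid rcomp tid tcomp dc empty sum] := mackeyP M.
split=> [X q|X Y Z g f q|X q|X Y Z g f q|X Y Z P g f f' g' pb q|X X0 q|X Y p q].
- by have [x <-] := quot_pi_surj q; rewrite quot_resE rid.
- have [x <-] := quot_pi_surj q.
  by rewrite (quot_resE g) (quot_resE f) (quot_resE (gcomp g f)) rcomp.
- by have [x <-] := quot_pi_surj q; rewrite quot_trE tid.
- have [x <-] := quot_pi_surj q.
  by rewrite (quot_trE f) (quot_trE g) (quot_trE (gcomp g f)) tcomp.
- have [x <-] := quot_pi_surj q.
  rewrite (quot_trE f) (quot_resE g) (quot_resE g') (quot_trE f').
  by rewrite (dc _ _ _ _ _ _ _ _ pb).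
- by have [x <-] := quot_pi_surj q; rewrite (empty X X0 x) raddf0.
have [x <-] := quot_pi_surj p; have [y <-] := quot_pi_surj q.
have [z [[zx zy] _]] := sum X Y x y.
exists (quot_pi S _ z).
split=> [|r]; first by rewrite (quot_resE (ginl X Y)) (quot_resE (ginr X Y)) zx zy.
have [w <-] := quot_pi_surj r.
rewrite (quot_resE (ginl X Y)) (quot_resE (ginr X Y)).
move=> -[/quot_piP wx /quot_piP wy].
apply/quot_piP; rewrite -opprB; apply: smN.
by apply: sm_sum; rewrite raddfB ?zx ?zy.
Qed.
Definition quot_mackey : mackey gT := Mackey quot_is_mackey.

Definition quot_proj : mackey_map M quot_mackey :=
  @MackeyMap _ M quot_mackey (fun X => quot_pi S X)
    (fun X Y f x => esym (quot_resE f x))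
    (fun X Y f x => esym (quot_trE f x)).
End SubQuotMackey.

Definition kernel_submackey (gT : finGroupType) (M N : mackey gT)
  (h : mackey_map M N) : submackey M.
Proof.
apply: (@SubMackey gT M (fun X x => h X x = 0)) => [X|X x y x0 y0|X Y f y y0|X Y f x x0].
- by rewrite raddf0.
- by rewrite raddfB x0 y0 subrr.
- by rewrite mmap_res y0 raddf0.
- by rewrite mmap_tr x0 raddf0.
Defined.

Section Green.
Variable gT : finGroupType.
Implicit Types X Y Z : gset gT.

(* A commutative monoid for the box product, unfolded: R(X) is a commutative
   ring, possibly zero, restrictions are ring maps, and transfers satisfy
   Frobenius reciprocity *)
Record green := Green {
  gobj :> gset gT -> comPzRingType;
  gres : forall X Y, gmap X Y -> {rmorphism gobj Y -> gobj X};
  gtr : forall X Y, gmap X Y -> {additive gobj X -> gobj Y};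
  green_mackeyP : is_mackey (M := fun X => gobj X)
    (fun X Y f => gres f) gtr;
  green_frob : forall X Y (f : gmap X Y) (x : gobj X) (y : gobj Y),
    gtr f (gres f y * x) = y * gtr f x
}.

Definition green_mackey (R : green) : mackey gT := Mackey (green_mackeyP R).

(* A module over the monoid R, unfolded in the same way: the two Frobenius
   laws and wresZ say that the action is a map R [x] W -> W *)
Record gmodule (R : green) := GModule {
  wobj :> forall X, lmodType (R X);
  wres : forall X Y, gmap X Y -> {additive wobj Y -> wobj X};
  wtr : forall X Y, gmap X Y -> {additive wobj X -> wobj Y};
  module_mackeyP : is_mackey (M := fun X => wobj X) wres wtr;
  wresZ : forall X Y (f : gmap X Y) (r : R Y) (w : wobj Y),
    wres f (r *: w) = gres R f r *: wres f w;
  wfrob : forall X Y (f : gmap X Y) (r : R Y) (w : wobj X),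
    wtr f (gres R f r *: w) = r *: wtr f w;
  wfrob_tr : forall X Y (f : gmap X Y) (r : R X) (w : wobj Y),
    wtr f (r *: wres f w) = gtr R f r *: w
}.

Definition module_mackey (R : green) (W : gmodule R) : mackey gT :=
  Mackey (module_mackeyP W).

Definition is_linear (R : green) (V W : gmodule R)
    (h : mackey_map (module_mackey V) (module_mackey W)) : Prop :=
  forall X (r : R X) (v : V X), h X (r *: v) = r *: (h X v : W X).

Record gmod_hom (R : green) (V W : gmodule R) := GModHom {
  hom_map :> mackey_map (module_mackey V) (module_mackey W);
  hom_linear : is_linear hom_map
}.

(* The maps of Mackey functors out of M range over all finite G-sets, so they
   form too large a type to carry a zmodType structure; their pointwise sum
   is kept as a plain operation. *)
Lemma hom_add_subproof (R : green) (V W : gmodule R) (h k : gmod_hom V W) :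
  is_linear (mmap_add h k).
Proof. by move=> X r v /=; rewrite !hom_linear scalerDr. Qed.
Definition hom_add (R : green) (V W : gmodule R) (h k : gmod_hom V W) :
  gmod_hom V W := GModHom (hom_add_subproof h k).

End Green.

Section Tambara.
Variables (gT : finGroupType) (O : indexing_system gT).
Implicit Types X Y Z E P : gset gT.

Record tambara := Tambara {
  tgreen :> green gT;
  tnm : forall X Y (f : gmap X Y), admissible O f -> tgreen X -> tgreen Y;
  tnm_id : forall X (a : admissible O (gid X)) x, tnm a x = x;
  tnm_comp : forall X Y Z (g : gmap Y Z) (f : gmap X Y)
    (ag : admissible O g) (af : admissible O f)
    (agf : admissible O (gcomp g f)) x, tnm agf x = tnm ag (tnm af x);
  tnm1 : forall X Y (f : gmap X Y) (a : admissible O f), tnm a 1 = 1;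
  tnmM : forall X Y (f : gmap X Y) (a : admissible O f) x y,
    tnm a (x * y) = tnm a x * tnm a y;
  tnm_fold : forall X (a : admissible O (gfold X)) z,
    tnm a z = gres tgreen (ginl X X) z * gres tgreen (ginr X X) z;
  tnm_dc : forall X Y Z P (g : gmap Z Y) (f : gmap X Y)
    (f' : gmap P Z) (g' : gmap P X)
    (a : admissible O f) (a' : admissible O f'), is_pullback g f f' g' ->
    forall x, gres tgreen g (tnm a x) = tnm a' (gres tgreen g' x);
  tnm_tr : forall X Y E X' P (f : gmap X Y) (p : gmap E X) (e : gmap X' E)
    (f' : gmap X' P) (q : gmap P Y)
    (a : admissible O f) (a' : admissible O f'), is_exponential f p e f' q ->
    forall x, tnm a (gtr tgreen p x) = gtr tgreen q (tnm a' (gres tgreen e x))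
}.

Arguments tnm t {X Y f} a x : rename.

Record tambara_map (A B : tambara) := TambaraMap {
  tmap :> forall X, {rmorphism A X -> B X};
  tmap_res : forall X Y (f : gmap X Y) x,
    tmap X (gres A f x) = gres B f (tmap Y x);
  tmap_tr : forall X Y (f : gmap X Y) x,
    tmap Y (gtr A f x) = gtr B f (tmap X x);
  tmap_nm : forall X Y (f : gmap X Y) (a : admissible O f) x,
    tmap Y (tnm A a x) = tnm B a (tmap X x)
}.

(* What a map of Mackey functors B [x]_A B' -> M unfolds to *)
Record dress_pairing (A B B' : tambara) (phi : tambara_map A B)
    (psi : tambara_map A B') (M : mackey gT) := DressPairing {
  dp :> forall X, B X -> B' X -> M X;
  dpDl : forall X x y (z : B' X), dp (x + y) z = dp x z + dp y z;
  dpDr : forall X (x : B X) y z, dp x (y + z) = dp x y + dp x z;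
  dp_res : forall X Y (f : gmap X Y) (x : B Y) (y : B' Y),
    dp (gres B f x) (gres B' f y) = mres M f (dp x y);
  dp_trl : forall X Y (f : gmap X Y) (x : B X) (y : B' Y),
    mtr M f (dp x (gres B' f y)) = dp (gtr B f x) y;
  dp_trr : forall X Y (f : gmap X Y) (x : B Y) (y : B' X),
    mtr M f (dp (gres B f x) y) = dp x (gtr B' f y);
  dp_bal : forall X (a : A X) (x : B X) (y : B' X),
    dp (x * phi X a) y = dp x (psi X a * y)
}.

(* The relative box product B [x]_A B' of two A-algebras: an O-Tambara functor
   under B and B', agreeing on A, such that b [x] b' := rb1 b * rb2 b' is the
   universal A-balanced pairing.  This determines its Green functor structure,
   and its norms, up to unique isomorphism. *)
Record relbox (A B B' : tambara) (phi : tambara_map A B)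
    (psi : tambara_map A B') := RelBox {
  rb :> tambara;
  rb1 : tambara_map B rb;
  rb2 : tambara_map B' rb;
  rb_comm : forall X (a : A X), rb1 X (phi X a) = rb2 X (psi X a);
  rb_univ : forall (M : mackey gT) (theta : dress_pairing phi psi M),
    exists! h : mackey_map (green_mackey rb) M,
      forall X (b : B X) (b' : B' X), h X (rb1 X b * rb2 X b') = theta X b b'
}.

Definition is_ideal (R : tambara) (J : forall X, R X -> Prop) : Prop :=
  exists (S : tambara) (h : tambara_map R S), forall X x, J X x <-> h X x = 0.

Lemma ideal0 R J : @is_ideal R J -> forall X, J X 0.
Proof. by move=> [S [h hJ]] X; apply/hJ; rewrite rmorph0. Qed.
Lemma idealB R J : @is_ideal R J ->
  forall X x y, J X x -> J X y -> J X (x - y).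
Proof. by move=> [S [h hJ]] X x y /hJ x0 /hJ y0; apply/hJ; rewrite rmorphB x0 y0 subrr. Qed.
Lemma idealM R J : @is_ideal R J -> forall X (r x : R X), J X x -> J X (r * x).
Proof. by move=> [S [h hJ]] X r x /hJ x0; apply/hJ; rewrite rmorphM x0 mulr0. Qed.
Lemma ideal_res R J : @is_ideal R J ->
  forall X Y (f : gmap X Y) y, J Y y -> J X (gres R f y).
Proof. by move=> [S [h hJ]] X Y f y /hJ y0; apply/hJ; rewrite tmap_res y0 rmorph0. Qed.
Lemma ideal_tr R J : @is_ideal R J ->
  forall X Y (f : gmap X Y) x, J X x -> J Y (gtr R f x).
Proof. by move=> [S [h hJ]] X Y f x /hJ x0; apply/hJ; rewrite tmap_tr x0 raddf0. Qed.

Section BoxInduction.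
Variables (A B B' : tambara) (phi : tambara_map A B) (psi : tambara_map A B').
Variable C : relbox phi psi.

Definition rb_pairing (M : mackey gT) (h : mackey_map (green_mackey C) M) :
  dress_pairing phi psi M.
Proof.
apply: (@DressPairing _ _ _ _ _ M (fun X b b' => h X (rb1 C X b * rb2 C X b'))).
- by move=> X x y z; rewrite rmorphD mulrDl raddfD.
- by move=> X x y z; rewrite rmorphD mulrDr raddfD.
- move=> X Y f x y; rewrite -(mmap_res h) /=.
  by rewrite !tmap_res -rmorphM.
- move=> X Y f x y; rewrite -(mmap_tr h) /=.
  by rewrite tmap_res mulrC green_frob tmap_tr mulrC.
- move=> X Y f x y; rewrite -(mmap_tr h) /=.
  by rewrite tmap_res green_frob tmap_tr.
- by move=> X a x y; rewrite !rmorphM rb_comm mulrA.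
Defined.

Lemma rb_ind (S : submackey (green_mackey C)) :
  (forall X b b', S X (rb1 C X b * rb2 C X b')) -> forall X c, S X c.
Proof.
move=> gen X c; pose Q := quot_mackey S; pose pi := quot_proj S.
have [z zP] : exists z : mackey_map (green_mackey C) Q, forall Y c, z Y c = 0.
  by exists (@MackeyMap _ (green_mackey C) Q
    (fun Y => \0 : {additive green_mackey C Y -> Q Y})
    (fun _ _ _ _ => esym (raddf0 _)) (fun _ _ _ _ => esym (raddf0 _))).
have [w [_ uniq]] := rb_univ C (rb_pairing pi).
have e : pi = z.
  rewrite -(uniq pi) // ; apply: uniq => Y b b'; rewrite zP.
  suff : quot_pi S Y 0 = quot_pi S Y (rb1 C Y b * rb2 C Y b').
    by rewrite raddf0.
  by apply/quot_piP; rewrite sub0r; apply: smN; apply: gen.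
have : quot_pi S X c = quot_pi S X 0.
  by rewrite raddf0; have := zP X c; rewrite -e.
by move/quot_piP; rewrite subr0.
Qed.
End BoxInduction.
End Tambara.
Arguments tnm {gT O} t {X Y f} a x : rename.

Section Derivations.
Variables (gT : finGroupType) (O : indexing_system gT).
Variables (A B : tambara O) (phi : tambara_map A B).
Implicit Types X Y : gset gT.

Definition is_derivation (W : gmodule B)
    (d : mackey_map (green_mackey B) (module_mackey W)) : Prop :=
  (forall X (a : A X), d X (phi X a) = 0) /\
  (forall X Y (f : gmap X Y) (a : admissible O f) (s : B X),
    d Y (tnm B a s) =
    wtr W f (tnm B (admissible_pi2 a) (gres B (gpi1 f) s) *: (d X s : W X))).

Record der (W : gmodule B) := Der {
  der_map :> mackey_map (green_mackey B) (module_mackey W);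
  derP : is_derivation der_map
}.

Lemma der_add_subproof (W : gmodule B) (d e : der W) :
  is_derivation (mmap_add d e).
Proof.
have [d0 dN] := derP d; have [e0 eN] := derP e.
split=> [X a|X Y f a s] /=; first by rewrite d0 e0 addr0.
by rewrite dN eN -raddfD -scalerDr.
Qed.
Definition der_add (W : gmodule B) (d e : der W) : der W :=
  Der (der_add_subproof d e).

End Derivations.

Section Kaehler.
Variables (gT : finGroupType) (O : indexing_system gT).
Variables (A B : tambara O) (phi : tambara_map A B) (C : relbox phi phi).
Implicit Types X Y Z : gset gT.

Definition mult_pairing : dress_pairing phi phi (green_mackey B).
Proof.
apply: (@DressPairing _ _ _ _ _ _ _ (green_mackey B)
  (fun X b b' => b * b' : B X)).
- by move=> X x y z; rewrite mulrDl.
- by move=> X x y z; rewrite mulrDr.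
- by move=> X Y f x y; rewrite -rmorphM.
- by move=> X Y f x y; rewrite /= mulrC green_frob mulrC.
- by move=> X Y f x y; rewrite /= green_frob.
- by move=> X a x y; rewrite mulrA.
Defined.

Definition codiag : mackey_map (green_mackey C) (green_mackey B) :=
  projT1 (cid (rb_univ C mult_pairing)).

Lemma codiagE X b b' : codiag X (rb1 C X b * rb2 C X b') = b * b'.
Proof. by rewrite /codiag; case: cid => h [hP _] /=; rewrite hP. Qed.

Lemma codiag_mull X b c : codiag X (rb1 C X b * c) = b * codiag X c.
Proof.
pose P Z (c : C Z) := forall Y (f : gmap Y Z) b,
  codiag Y (rb1 C Y b * gres C f c) = b * codiag Y (gres C f c).
have [S SE] : exists S : submackey (green_mackey C), forall Z c, S Z c <-> P Z c.
  have [_ rcomp _ _ dc _ _] := green_mackeyP C.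
  have [_ _ _ _ dcB _ _] := green_mackeyP B.
  suff [S0 SB Sres Str] : [/\ forall Z, P Z 0,
      forall Z x y, P Z x -> P Z y -> P Z (x - y),
      forall Y Z (f : gmap Y Z) y, P Z y -> P Y (gres C f y) &
      forall Y Z (f : gmap Y Z) x, P Y x -> P Z (gtr C f x)].
    by exists (@SubMackey _ (green_mackey C) P S0 SB Sres Str).
  split=> [Z Y f b'|Z x y Px Py Y f b'|Y Z f y Py V g b'|Y Z f x Px V g b'].
  - by rewrite rmorph0 mulr0 raddf0 mulr0.
  - by rewrite rmorphB mulrBr !raddfB Px Py mulrBr.
  - by rewrite -rcomp; apply: Py.
  rewrite (dc _ _ _ _ _ _ _ _ (gpbP g f)) -green_frob -tmap_res.
  have trE Q R (k : gmap Q R) z : codiag R (gtr C k z) = gtr B k (codiag Q z).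
    exact: (mmap_tr codiag).
  by rewrite !trE Px green_frob.
suff : P X c.
  have [rid _ _ _ _ _ _] := green_mackeyP C.
  by move=> /(_ X (gid X) b); rewrite rid.
apply/SE; apply: rb_ind => Z x y; apply/SE => Y f b'.
by rewrite rmorphM -!tmap_res mulrA -rmorphM !codiagE mulrA.
Qed.

Definition aug : submackey (green_mackey C) := kernel_submackey codiag.

Lemma aug_mul X (b : B X) c : aug X c -> aug X (rb1 C X b * c).
Proof. by rewrite /aug /= codiag_mull => ->; rewrite mulr0. Qed.

(* An intersection of kernels is again a kernel, so this is the smallest one *)
Definition aug_gt1_ideal X (c : C X) : Prop :=
  forall J : (forall Y, C Y -> Prop), is_ideal J ->
    (forall Y Z (f : gmap Y Z) (a : admissible O f) (i : C Y),
      two_surjective f -> aug Y i -> J Z (tnm C a i)) ->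
    J X c.

Definition aug_gt1 : submackey (sub_mackey aug).
Proof.
apply: (@SubMackey _ (sub_mackey aug)
  (fun X (i : sub_car aug X) => aug_gt1_ideal (val i : C X)))
  => [X|X x y Ix Iy|X Y f y Iy|X Y f x Ix] J idJ gen.
- exact: ideal0.
- by rewrite raddfB; apply: idealB => //; [apply: Ix | apply: Iy].
- by apply: ideal_res => //; apply: Iy.
- by apply: ideal_tr => //; apply: Ix.
Defined.

(* I / I^{>1}; below, b in B acts on it as multiplication by b [x] 1, which
   agrees with 1 [x] b since I * I is contained in I^{>1} *)
Definition kaehler_mackey : mackey gT := quot_mackey aug_gt1.

Section Scale.
Variable X : gset gT.
Notation OmX := (kaehler_mackey X).
Definition aug_scale (b : B X) (i : sub_car aug X) : sub_car aug X :=
  sub_in (aug_mul b (sub_out i)).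
Definition kaehler_scale (b : B X) (q : OmX) : OmX :=
  quot_pi aug_gt1 X (aug_scale b (generic_quotient.repr (q : quot_car _ _))).

Lemma kaehler_scaleE b i :
  kaehler_scale b (quot_pi aug_gt1 X i) = quot_pi aug_gt1 X (aug_scale b i).
Proof.
rewrite /kaehler_scale; set j := generic_quotient.repr _.
have ji : aug_gt1 X (j - i) by apply/quot_piP; rewrite [LHS]reprK.
apply/quot_piP => J idJ gen; rewrite raddfB /= -mulrBr; apply: idealM => //.
exact: ji.
Qed.

Lemma kaehler_scaleA b b' q :
  kaehler_scale b (kaehler_scale b' q) = kaehler_scale (b * b') q.
Proof.
have [i <-] := quot_pi_surj q.
rewrite (kaehler_scaleE b' i) (kaehler_scaleE b) (kaehler_scaleE (b * b')).
by congr (quot_pi _ _ _); apply: val_inj; rewrite /= rmorphM mulrA.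
Qed.
Lemma kaehler_scale1 : left_id 1 kaehler_scale.
Proof.
move=> q; have [i <-] := quot_pi_surj q; rewrite kaehler_scaleE.
by congr (quot_pi _ _ _); apply: val_inj; rewrite /= rmorph1 mul1r.
Qed.
Lemma kaehler_scaleDr : right_distributive kaehler_scale +%R.
Proof.
move=> b q r; have [i <-] := quot_pi_surj q; have [j <-] := quot_pi_surj r.
rewrite -raddfD (kaehler_scaleE b i) (kaehler_scaleE b j) kaehler_scaleE -raddfD.
by congr (quot_pi _ _ _); apply: val_inj; rewrite /= mulrDr.
Qed.
Lemma kaehler_scaleDl q : {morph kaehler_scale^~ q : b b' / b + b'}.
Proof.
move=> b b'; have [i <-] := quot_pi_surj q.
rewrite (kaehler_scaleE b i) (kaehler_scaleE b' i) kaehler_scaleE -raddfD.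
by congr (quot_pi _ _ _); apply: val_inj; rewrite /= rmorphD mulrDl.
Qed.

Definition kaehler_lmod : lmodType (B X) :=
  HB.pack (OmX : Type) (GRing.Zmodule.on OmX)
    (GRing.Zmodule_isLmodule.Build (B X) OmX
      kaehler_scaleA kaehler_scale1 kaehler_scaleDr kaehler_scaleDl).
End Scale.

Lemma kaehler_resZ X Y (f : gmap X Y) (r : B Y) (w : kaehler_lmod Y) :
  mres kaehler_mackey f (r *: w) =
  (gres B f r *: (mres kaehler_mackey f w : kaehler_lmod X) : kaehler_lmod X).
Proof.
have [i <-] := quot_pi_surj (w : quot_car aug_gt1 Y).
rewrite -[r *: _]/(kaehler_scale r _) -[RHS]/(kaehler_scale _ _).
rewrite kaehler_scaleE (quot_resE aug_gt1 f) (quot_resE aug_gt1 f) kaehler_scaleE.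
by congr (quot_pi _ _ _); apply: val_inj; rewrite /= rmorphM tmap_res.
Qed.

Lemma kaehler_frob X Y (f : gmap X Y) (r : B Y) (w : kaehler_lmod X) :
  mtr kaehler_mackey f (gres B f r *: w) =
  (r *: (mtr kaehler_mackey f w : kaehler_lmod Y) : kaehler_lmod Y).
Proof.
have [i <-] := quot_pi_surj (w : quot_car aug_gt1 X).
rewrite -[_ *: _ in LHS]/(kaehler_scale _ _) -[RHS]/(kaehler_scale _ _).
rewrite kaehler_scaleE (quot_trE aug_gt1 f) (quot_trE aug_gt1 f) kaehler_scaleE.
by congr (quot_pi _ _ _); apply: val_inj; rewrite /= tmap_res green_frob.
Qed.

Lemma kaehler_frob_tr X Y (f : gmap X Y) (r : B X) (w : kaehler_lmod Y) :
  mtr kaehler_mackey f (r *: (mres kaehler_mackey f w : kaehler_lmod X)) =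
  (gtr B f r *: w : kaehler_lmod Y).
Proof.
have [i <-] := quot_pi_surj (w : quot_car aug_gt1 Y).
rewrite -[_ *: _ in LHS]/(kaehler_scale _ _) -[RHS]/(kaehler_scale _ _).
rewrite (quot_resE aug_gt1 f) kaehler_scaleE (quot_trE aug_gt1 f) kaehler_scaleE.
congr (quot_pi _ _ _); apply: val_inj.
by rewrite /= mulrC green_frob tmap_tr mulrC.
Qed.

Definition kaehler : gmodule B :=
  @GModule gT B kaehler_lmod (mres kaehler_mackey) (mtr kaehler_mackey)
    (mackeyP kaehler_mackey) kaehler_resZ kaehler_frob kaehler_frob_tr.

Lemma delta_subproof X (b : B X) : aug X (rb2 C X b - rb1 C X b).
Proof.
rewrite /aug /= raddfB -[rb2 C X b]mul1r -{1}(rmorph1 (rb1 C X)).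
by rewrite -[rb1 C X b]mulr1 -(rmorph1 (rb2 C X)) !codiagE mul1r mulr1 subrr.
Qed.
Definition delta_fun X (b : B X) : kaehler X :=
  quot_pi aug_gt1 X (sub_in (delta_subproof b)).
Lemma delta_additive X : zmod_morphism (@delta_fun X).
Proof.
move=> b b'; rewrite /delta_fun -raddfB; congr (quot_pi _ _ _).
apply: val_inj; rewrite /= !rmorphB !opprB addrACA [RHS]addrACA.
by congr (_ + _); rewrite addrC.
Qed.
Lemma delta_res X Y (f : gmap X Y) b :
  delta_fun (gres B f b) = wres kaehler f (delta_fun b).
Proof.
rewrite [RHS](quot_resE aug_gt1 f); congr (quot_pi _ _ _).
by apply: val_inj; rewrite /= rmorphB !tmap_res.
Qed.
Lemma delta_tr X Y (f : gmap X Y) b :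
  delta_fun (gtr B f b) = wtr kaehler f (delta_fun b).
Proof.
rewrite [RHS](quot_trE aug_gt1 f); congr (quot_pi _ _ _).
by apply: val_inj; rewrite /= raddfB !tmap_tr.
Qed.
Definition delta : mackey_map (green_mackey B) (module_mackey kaehler) :=
  @MackeyMap gT (green_mackey B) (module_mackey kaehler)
    (fun X => mk_additive (@delta_additive X)) delta_res delta_tr.

End Kaehler.

(* Main.v *)
From HB Require Import structures.
From mathcomp Require Import all_boot all_algebra all_fingroup.
From mathcomp Require Import boolp.
Require Import Defs.

Set Implicit Arguments.
Unset Strict Implicit.
Unset Printing Implicit Defensive.

Import GRing.Theory.
Local Open Scope ring_scope.

(** Norms are computed throughout from Tambara reciprocity.

    The composite h o delta is a derivation because delta is one.  With
    x = b [x] 1 and i = 1 [x] b - b [x] 1, the norm 1 [x] N_f b = N_f (x + i)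
    is a sum over the ways of choosing x or i at each point of a fibre of f.
    Choosing i nowhere gives N_f x; choosing it at one point gives the transfer
    occurring in the definition of a derivation; choosing it at two points or
    more gives a transfer of a multiple of the norm of a restriction of i along
    a 2-surjective map, which lies in I^{>1} ([tnmD_expansion]).

    Injectivity of h |-> h o delta holds because each element of the box
    product is a single transfer T_p (b [x] b') ([relbox_transferP]), so that
    each element of I is T_p (b [x] 1 * (1 [x] b' - b' [x] 1))
    ([aug_transferP]): the module of differentials is generated by the image
    of delta.

    For surjectivity, a derivation d satisfies the Leibniz rule (its formula
    for a fold map, [derM]), so that b [x] b' |-> b . d b' is a balanced
    pairing and extends to a map theta from the box product to W ([der_ext]).
    It must vanish on I^{>1}.  Conceptually, with mu the codiagonal, (mu, theta)
    is a map of Tambara functors from the box product to the square-zero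
    extension of B by W, whose norms are
       N_f (b, w) = (N_f b, T_f (N_pi2 R_pi1 b . w)),
    and the norm of (0, w) along a 2-surjective map is 0 because both f and
    pi2 are then surjective.  Verifying the axioms for the square-zero
    extension is avoided: since (mu, theta) has the norms displayed above
    ([codiag_nm], [der_ext_nm]), its kernel is an ideal stable under the
    congruence that it defines for norms, and the quotient of the box product
    by such an ideal inherits all the axioms ([norm_congruence_ideal]).  The
    formula for theta (N_f c) rests on the exponential diagram obtained from
    one for f and p by removing a marked point from the fibres of f
    ([punct_exponential]). *)

(** * Finite G-sets and admissible maps *)

Section GSetTheory.
Variable gT : finGroupType.
Implicit Types X Y Z E P : gset gT.

Definition gsum_fun X0 X1 Y0 Y1 (f0 : gmap X0 Y0) (f1 : gmap X1 Y1)
    (z : gset_sum X0 X1) : gset_sum Y0 Y1 :=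
  match z with inl x => inl (f0 x) | inr x => inr (f1 x) end.
Lemma gsum_subproof X0 X1 Y0 Y1 (f0 : gmap X0 Y0) (f1 : gmap X1 Y1) z a :
  gsum_fun f0 f1 (gact (gset_sum X0 X1) z a) =
  gact (gset_sum Y0 Y1) (gsum_fun f0 f1 z) a.
Proof. by case: z => x /=; rewrite gmapP. Qed.
Definition gsum X0 X1 Y0 Y1 (f0 : gmap X0 Y0) (f1 : gmap X1 Y1) :
  gmap (gset_sum X0 X1) (gset_sum Y0 Y1) := GMap (gsum_subproof f0 f1).

Definition gcopair X0 X1 Y (f0 : gmap X0 Y) (f1 : gmap X1 Y) :
  gmap (gset_sum X0 X1) Y := gcomp (gfold Y) (gsum f0 f1).

Lemma gcopair_inl X0 X1 Y (f0 : gmap X0 Y) (f1 : gmap X1 Y) :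
  gcomp (gcopair f0 f1) (ginl X0 X1) = f0.
Proof. exact: gmap_eq. Qed.
Lemma gcopair_inr X0 X1 Y (f0 : gmap X0 Y) (f1 : gmap X1 Y) :
  gcomp (gcopair f0 f1) (ginr X0 X1) = f1.
Proof. exact: gmap_eq. Qed.

Lemma gcompA X Y Z E (h : gmap Z E) (g : gmap Y Z) (f : gmap X Y) :
  gcomp h (gcomp g f) = gcomp (gcomp h g) f.
Proof. exact: gmap_eq. Qed.

Lemma pullback_inj X Y Z P (g : gmap Z Y) (f : gmap X Y)
    (f' : gmap P Z) (g' : gmap P X) :
  is_pullback g f f' g' -> injective (fun w => (f' w, g' w)).
Proof.
case=> comm ex w w' [e1 e2].
have [v [_ u]] := ex (f' w) (g' w) (comm w).
by rewrite -(u w) // -(u w').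
Qed.

Lemma gstabP X (x : X) a : reflect (gact X x a = x) (a \in gstab x).
Proof. exact: astab1P. Qed.

Lemma gstab_inj X Y (f : gmap X Y) (x : X) :
  injective f -> gstab (f x) = gstab x.
Proof.
move=> fI; apply/val_inj/setP=> a.
by apply/gstabP/gstabP=> [|e]; rewrite -gmapP ?e // => /fI.
Qed.

Lemma horbit_triv (H : {group gT}) :
  giso (gset_triv (subg_of H) unit) (horbit H H).
Proof.
have memH : (H : {set gT}) \in rcosets H H.
  by rewrite -[X in X \in _](mulg1) mem_rcosets /= mulGid group1.
pose j (u : unit) : horbit H H := exist (fun S => S \in rcosets H H) _ memH.
have jE (S : horbit H H) : j tt = S.
  apply: val_inj; case: S => S /= /rcosetsP[x xH ->].
  by rewrite rcoset_id.
have jP (u : gset_triv (subg_of H) unit) a :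
    j (gact _ u a) = gact (horbit H H) (j u) a.
  exact: jE.
exists (GMap jP); exists (fun=> tt); first by case.
by move=> S; apply: jE.
Qed.

Variable O : indexing_system gT.

(** The orbit of a stabiliser in itself is a point, which belongs to every
    indexing system. *)
Lemma admissible_stab X Y (f : gmap X Y) :
  (forall x, gstab (f x) = gstab x) -> admissible O f.
Proof.
move=> fs x; rewrite fs; apply: isys_iso (horbit_triv _) _.
exact: isys_triv.
Qed.

Lemma admissible_inj X Y (f : gmap X Y) : injective f -> admissible O f.
Proof. by move=> fI; apply: admissible_stab => x; apply: gstab_inj. Qed.

Lemma gstab_inl X Y (x : X) : gstab (inl x : gset_sum X Y) = gstab x.
Proof. by apply: (@gstab_inj _ _ (ginl X Y)) => ? ? []. Qed.
Lemma gstab_inr X Y (y : Y) : gstab (inr y : gset_sum X Y) = gstab y.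
Proof. by apply: (@gstab_inj _ _ (ginr X Y)) => ? ? []. Qed.

Lemma admissible_id X : admissible O (gid X).
Proof. exact: admissible_inj. Qed.

Lemma admissible_fold X : admissible O (gfold X).
Proof.
by apply: admissible_stab => -[x|x]; rewrite ?gstab_inl ?gstab_inr.
Qed.

Lemma admissible_sum X0 X1 Y0 Y1 (f0 : gmap X0 Y0) (f1 : gmap X1 Y1) :
  admissible O f0 -> admissible O f1 -> admissible O (gsum f0 f1).
Proof.
by move=> a0 a1 [x|x] /=; rewrite ?gstab_inl ?gstab_inr.
Qed.

Lemma admissible_copair X0 X1 Y (f0 : gmap X0 Y) (f1 : gmap X1 Y) :
  admissible O f0 -> admissible O f1 -> admissible O (gcopair f0 f1).
Proof.
by move=> a0 a1 [x|x] /=; rewrite ?gstab_inl ?gstab_inr.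
Qed.

Lemma admissible_base_change X Y Z P (g : gmap Z Y) (f : gmap X Y)
    (f' : gmap P Z) (g' : gmap P X) :
  is_pullback g f f' g' -> admissible O f -> admissible O f'.
Proof.
move=> pb; apply: (admissible_pullback (pullback_inj pb)).
by case: pb.
Qed.

End GSetTheory.

(** * Mackey, Green and module identities *)

Section MackeyTheory.
Variables (gT : finGroupType) (M : mackey gT).
Implicit Types X Y Z P : gset gT.

Lemma mtr_comp X Y Z (g : gmap Y Z) (f : gmap X Y) (x : M X) :
  mtr M (gcomp g f) x = mtr M g (mtr M f x).
Proof. exact: (mk_tr_comp (mackeyP M)). Qed.
Lemma mtr_copair X0 X1 Y (f0 : gmap X0 Y) (f1 : gmap X1 Y) z :
  mtr M (gcopair f0 f1) z =
  mtr M f0 (mres M (ginl X0 X1) z) + mtr M f1 (mres M (ginr X0 X1) z).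
Proof.
rewrite {1}(mackey_split z) raddfD -!mtr_comp.
by rewrite gcopair_inl gcopair_inr.
Qed.

Lemma mtr_fold X (z : M (gset_sum X X)) :
  mtr M (gfold X) z = mres M (ginl X X) z + mres M (ginr X X) z.
Proof.
have -> : gfold X = gcopair (gid X) (gid X) by apply: gmap_eq => -[].
by rewrite mtr_copair !(mk_tr_id (mackeyP M)).
Qed.

(** The source of a bijection is a pullback of two identities, so this is an
    instance of the double coset formula. *)
Lemma mtr_mres_bij X Y (f : gmap X Y) (y : M Y) :
  bijective f -> mtr M f (mres M f y) = y.
Proof.
move=> [g fg gf].
have pb : is_pullback (gid Y) (gid Y) f f.
  split=> // z x /= <-; exists (g z); split=> [|w [<- _]]; by rewrite ?gf ?fg.
rewrite -(mk_dc (mackeyP M) pb).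
by rewrite (mk_tr_id (mackeyP M)) (mk_res_id (mackeyP M)).
Qed.

Lemma mackey_glue X Y (x : M X) (y : M Y) : exists z : M (gset_sum X Y),
  mres M (ginl X Y) z = x /\ mres M (ginr X Y) z = y.
Proof. by have [z [h _]] := mk_sum (mackeyP M) x y; exists z. Qed.

End MackeyTheory.

Section GreenTheory.
Variables (gT : finGroupType) (R : green gT).
Implicit Types X Y Z P : gset gT.

Lemma gres_id X (x : R X) : gres R (gid X) x = x.
Proof. exact: (mk_res_id (green_mackeyP R)). Qed.
Lemma gres_comp X Y Z (g : gmap Y Z) (f : gmap X Y) (x : R Z) :
  gres R (gcomp g f) x = gres R f (gres R g x).
Proof. exact: (mk_res_comp (green_mackeyP R)). Qed.
Lemma gtr_id X (x : R X) : gtr R (gid X) x = x.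
Proof. exact: (mk_tr_id (green_mackeyP R)). Qed.
Lemma gtr_comp X Y Z (g : gmap Y Z) (f : gmap X Y) (x : R X) :
  gtr R (gcomp g f) x = gtr R g (gtr R f x).
Proof. exact: (mk_tr_comp (green_mackeyP R)). Qed.
Lemma gtr_dc X Y Z P (g : gmap Z Y) (f : gmap X Y) (f' : gmap P Z)
    (g' : gmap P X) : is_pullback g f f' g' ->
  forall x, gres R g (gtr R f x) = gtr R f' (gres R g' x).
Proof. exact: (mk_dc (green_mackeyP R)). Qed.
Lemma gtr_copair X0 X1 Y (f0 : gmap X0 Y) (f1 : gmap X1 Y) z :
  gtr R (gcopair f0 f1) z =
  gtr R f0 (gres R (ginl X0 X1) z) + gtr R f1 (gres R (ginr X0 X1) z).
Proof. exact: (@mtr_copair gT (green_mackey R)). Qed.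
Lemma gtr_fold X z :
  gtr R (gfold X) z = gres R (ginl X X) z + gres R (ginr X X) z.
Proof. exact: (@mtr_fold gT (green_mackey R)). Qed.
Lemma green_glue X Y (x : R X) (y : R Y) : exists z : R (gset_sum X Y),
  gres R (ginl X Y) z = x /\ gres R (ginr X Y) z = y.
Proof. exact: (@mackey_glue gT (green_mackey R)). Qed.

Variable W : gmodule R.

Lemma wtr_comp X Y Z (g : gmap Y Z) (f : gmap X Y) (x : W X) :
  wtr W (gcomp g f) x = wtr W g (wtr W f x).
Proof. exact: (mk_tr_comp (module_mackeyP W)). Qed.
Lemma wtr_fold X z :
  wtr W (gfold X) z = wres W (ginl X X) z + wres W (ginr X X) z.
Proof. exact: (@mtr_fold gT (module_mackey W)). Qed.

End GreenTheory.

(** * Exponential diagrams *)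

Section Exponentials.
Variable gT : finGroupType.
Implicit Types X Y Z E P : gset gT.

Definition gset_pow X : gset gT := @GSet gT {set X} ((gact X)^*)%act.

Lemma mem_gset_pow X (S : gset_pow X) x a :
  (gact X x a \in (gact (gset_pow X) S a : {set X})) = (x \in (S : {set X})).
Proof. exact: (mem_imset (mem (S : {set X})) x (act_inj (gact X) a)). Qed.

Lemma mem_gset_powV X (S : gset_pow X) x a :
  (x \in (gact (gset_pow X) S a : {set X})) =
  (gact X x a^-1%g \in (S : {set X})).
Proof. by rewrite -(mem_gset_pow S _ a) -gactM mulVg gact1. Qed.

Lemma gactK X (x : X) a : gact X (gact X x a) a^-1%g = x.
Proof. by rewrite -gactM mulgV gact1. Qed.
Lemma gactKV X (x : X) a : gact X (gact X x a^-1%g) a = x.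
Proof. by rewrite -gactM mulVg gact1. Qed.

Lemma gmap_actV X Y (f : gmap X Y) x y a :
  f x = gact Y y a -> f (gact X x a^-1%g) = y.
Proof. by move=> e; rewrite gmapP e gactK. Qed.

Section DependentProduct.
Variables (X Y E : gset gT) (f : gmap X Y) (p : gmap E X).

(** A section of [p] over the fibre of [f] at [w.1] is encoded by its image
    [w.2], a subset of [E]: translating a subset by a group element needs no
    inverse, and evaluating the section at a point amounts to choosing an
    element of the subset. *)
Definition is_section (w : gset_prod Y (gset_pow E)) : bool :=
  `[< (forall x, f x = w.1 -> exists! e, e \in (w.2 : {set E}) /\ p e = x) /\
      (forall e, e \in (w.2 : {set E}) -> f (p e) = w.1) >].

Lemma is_section_act w a :
  is_section w -> is_section (gact (gset_prod Y (gset_pow E)) w a).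
Proof.
case: w => y S /asboolP[/= Sx Sf]; apply/asboolP; split=> /= [x fx|e].
  have [e [[eS pe] u]] := Sx _ (gmap_actV fx).
  exists (gact E e a); split.
    by rewrite mem_gset_pow gmapP pe gactKV.
  move=> e'; rewrite mem_gset_powV => -[e'S pe'].
  by rewrite (u (gact E e' a^-1%g)) ?gactKV // gmapP pe'.
by rewrite mem_gset_powV => /Sf; rewrite !gmapP => <-; rewrite gactKV.
Qed.
Definition dprod_set : gset gT := gset_sub is_section_act.
Definition dprod_base : gmap dprod_set Y :=
  @GMap _ dprod_set Y (fun t => (val t).1) (fun _ _ => erefl).

(** The points of the pullback of [f] along the dependent product are the pairs
    of a section and of one of its values: the argument is recovered from the
    value through [p]. *)
Definition in_section (w : gset_prod dprod_set E) : bool :=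
  w.2 \in ((val w.1).2 : {set E}).
Lemma in_section_act w a :
  in_section w -> in_section (gact (gset_prod dprod_set E) w a).
Proof. by rewrite /in_section /= mem_gset_pow. Qed.
Definition dprod_ev_set : gset gT := gset_sub in_section_act.
Definition dprod_pt : gmap dprod_ev_set dprod_set :=
  @GMap _ dprod_ev_set dprod_set (fun w => (val w).1) (fun _ _ => erefl).
Definition dprod_ev : gmap dprod_ev_set E :=
  @GMap _ dprod_ev_set E (fun w => (val w).2) (fun _ _ => erefl).

Lemma dprodP : is_exponential f p dprod_ev dprod_pt dprod_base.
Proof.
split.
  split=> [[[t e] et]|t x /= qf].
    by case: t et => -[y S] /= /[dup] /asboolP[_ Sf] h /Sf.
  case: t qf => -[y S] /= h yf; have /asboolP[Sx Sf] := h.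
  have [e [[eS pe] u]] := Sx x (esym yf).
  pose t : dprod_set := exist _ (y, S) h.
  have et : in_section (t, e) by [].
  exists (exist _ (t, e) et); split=> // -[[t' e'] /= et'] [tt' pe'].
  by apply: val_inj => /=; subst t'; rewrite (u e').
move=> y s sP.
have sE x1 x2 h1 h2 : x1 = x2 -> s x1 h1 = s x2 h2.
  by move=> e; subst x2; rewrite (Prop_irrelevance h1 h2).
pose S := [set e | `[< exists h : f (p e) = y, s (p e) h = e >]].
have SP e : reflect (exists h : f (p e) = y, s (p e) h = e) (e \in S).
  by rewrite inE; apply: asboolP.
have h : is_section ((y, S) : gset_prod Y (gset_pow E)).
  apply/asboolP; split=> /= [x fx|e /SP[]//].
  exists (s x fx); split=> [|e' [/SP[fe <-] pe']];
    last by apply: sE; rewrite -pe' sP.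
  split; last exact: sP.
  have fs : f (p (s x fx)) = y by rewrite sP.
  by apply/SP; exists fs; apply: sE; rewrite sP.
exists (exist _ (y, S) h); split.
  split=> // -[[t e] /= et] hx te; subst t.
  have /SP[fe se] := et.
  by transitivity (s (p e) fe); [rewrite se | apply: sE].
case=> -[y' S'] h' /= [e tP]; subst y'.
have S'P e (eS : e \in S') (hx : f (p e) = y) : e = s (p e) hx.
  pose t : dprod_set := exist _ (y, S') h'.
  have et : in_section (t, e) by [].
  exact: (tP (exist _ (t, e) et) hx).
have /asboolP[/= Sx Sf] := h'.
apply: val_inj; congr (_, _); apply/setP=> e; apply/SP/idP=> [[fe se]|eS].
  have [e' [[e'S pe'] _]] := Sx _ fe.
  have fe' : f (p e') = y by rewrite pe'.
  by rewrite -se (sE _ _ fe fe') // -(S'P _ e'S).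
by exists (Sf _ eS); rewrite -S'P.
Qed.

End DependentProduct.
End Exponentials.

(** Given an exponential diagram for [f] and [p], a point of [X'] is a section
    of [p] over a fibre of [f] together with a marked point of that fibre.
    It can also be seen as its value at the marked point, which is an element
    of [E], together with a section over the rest of the fibre.  The second
    description makes [e : X' -> E] a dependent product, along the family
    [punct_pt] of punctured fibres indexed by [E]; the pullback of this family
    along [e] is then the off-diagonal part of [X' x_P X']. *)
Section PuncturedExponential.
Variables (gT : finGroupType) (X Y E X' P : gset gT).
Variables (f : gmap X Y) (p : gmap E X) (e : gmap X' E).
Variables (f' : gmap X' P) (q : gmap P Y).
Hypothesis ex : is_exponential f p e f' q.

Definition punct := gpb p (gpi2 f).
Definition punct_pt : gmap punct E := gpb1 p (gpi2 f).
Definition punct_rest : gmap punct X := gcomp (gpi1 f) (gpb2 p (gpi2 f)).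
Definition punct_fibre := gpb punct_rest p.
Definition punct_base : gmap punct_fibre punct := gpb1 punct_rest p.
Definition punct_val : gmap punct_fibre E := gpb2 punct_rest p.

Lemma punctP u : [/\ f (punct_rest u) = f (p (punct_pt u)) &
  punct_rest u != p (punct_pt u)].
Proof. by case: u => -[a [[x1 x2] /= /andP[/eqP h n]]] /= /eqP ->. Qed.

Lemma punct_inj u v :
  punct_pt u = punct_pt v -> punct_rest u = punct_rest v -> u = v.
Proof.
case: u v => -[a [[x1 x2] ha]] ka [[b [[y1 y2] hb]] kb] /= eab exy.
apply: val_inj; rewrite /= eab; congr (_, _); apply: val_inj.
by move: ka kb; rewrite /= exy eab => /eqP <- /eqP <-.
Qed.

Lemma punct_fibreE v : p (punct_val v) = punct_rest (punct_base v).
Proof. by case: v => -[u a] /= /eqP ->. Qed.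

Lemma punct_fibre_inj v w : punct_pt (punct_base v) = punct_pt (punct_base w) ->
  punct_val v = punct_val w -> v = w.
Proof.
move=> e1 e2; apply: (pullback_inj (gpbP punct_rest p)).
rewrite -/punct_base -/punct_val e2; congr (_, _); apply: punct_inj => //.
by rewrite -!punct_fibreE e2.
Qed.

Lemma punct_exists a x : f x = f (p a) -> x != p a ->
  exists u : punct, punct_pt u = a /\ punct_rest u = x.
Proof.
move=> fx nx.
have h : (f (x, p a).1 == f (x, p a).2) && ((x, p a).1 != (x, p a).2).
  by rewrite /= fx eqxx.
pose o : goffdiag f := exist _ (x, p a) h.
have k : p (a, o).1 == gpi2 f (a, o).2 by [].
by exists (exist _ (a, o) k).
Qed.

Lemma punct_ev_subproof (w : goffdiag f') : exists v : punct_fibre,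
  punct_pt (punct_base v) = e (gpi2 f' w) /\ punct_val v = e (gpi1 f' w).
Proof.
case: w => -[w1 w2] /= /andP[/eqP e12 n12]; have [[pb1 pb2] _] := ex.
have fp w : f (p (e w)) = q (f' w) by rewrite -pb1.
have [||u [ue ux]] := @punct_exists (e w2) (p (e w1)); first by rewrite !fp e12.
  apply: contra n12 => /eqP pe; apply/eqP/(pullback_inj (conj pb1 pb2)).
  by rewrite /= e12 pe.
have k : punct_rest (u, e w1).1 == p (u, e w1).2 by rewrite ux.
by exists (exist _ (u, e w1) k).
Qed.

Definition punct_ev_fun (w : goffdiag f') : punct_fibre :=
  projT1 (cid (punct_ev_subproof w)).
Lemma punct_evE w :
  punct_pt (punct_base (punct_ev_fun w)) = e (gpi2 f' w) /\
  punct_val (punct_ev_fun w) = e (gpi1 f' w).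
Proof. by rewrite /punct_ev_fun; case: cid. Qed.

Lemma punct_ev_act w a :
  punct_ev_fun (gact (goffdiag f') w a) = gact punct_fibre (punct_ev_fun w) a.
Proof.
have [e1 e2] := punct_evE (gact _ w a); have [e3 e4] := punct_evE w.
apply: punct_fibre_inj; first by rewrite e1 !gmapP e3.
by rewrite e2 !gmapP e4.
Qed.
Definition punct_ev : gmap (goffdiag f') punct_fibre := GMap punct_ev_act.

Lemma punct_val_ev : gcomp punct_val punct_ev = gcomp e (gpi1 f').
Proof. by apply: gmap_eq => w; have [_] := punct_evE w. Qed.

Lemma punct_exponential :
  is_exponential punct_pt punct_base punct_ev (gpi2 f') e.
Proof.
have [[pb1 pb2] sec] := ex.
have fp w : f (p (e w)) = q (f' w) by rewrite -pb1.
split.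
  split=> [w|w2 u uw]; first by have [<-] := punct_evE w.
  have [fu nu] := punctP u.
  have [|w1 [[f'w1 pw1] w1u]] := pb2 (f' w2) (punct_rest u).
    by rewrite -fp fu uw.
  have h : (f' (w1, w2).1 == f' (w1, w2).2) && ((w1, w2).1 != (w1, w2).2).
    rewrite /= f'w1 eqxx /=; apply: contra nu => /eqP e12.
    by rewrite -pw1 e12 -uw.
  exists (exist _ (w1, w2) h); split.
    split=> //; have [h1 h2] := punct_evE (exist _ (w1, w2) h).
    apply: punct_inj; first by rewrite [LHS]h1.
    by rewrite -punct_fibreE [punct_val _]h2.
  move=> [[v1 v2] k] [v2E]; rewrite /= in v2E; subst v2.
  have [h1 h2] := punct_evE (exist _ (v1, w2) k) => uE.
  apply: val_inj; rewrite /=; congr (_, _); apply: w1u.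
  split; first by case/andP: (k) => /eqP.
  by rewrite -uE -punct_fibreE [punct_val _]h2.
move=> a s sP.
have sE u1 u2 h1 h2 : u1 = u2 -> s u1 h1 = s u2 h2.
  by move=> E12; subst u2; rewrite (Prop_irrelevance h1 h2).
have sv u h : p (punct_val (s u h)) = punct_rest u.
  by rewrite punct_fibreE sP.
(* s, given over the punctured fibre, extends by the value a at the puncture *)
have [s' [s'P s'a s'u]] : exists s' : forall x, f x = f (p a) -> E,
    [/\ forall x h, p (s' x h) = x, forall h, s' (p a) h = a &
        forall u hu h, s' (punct_rest u) h = punct_val (s u hu)].
  have pick x (h : f x = f (p a)) : {b : E | p b = x /\
      (x = p a -> b = a) /\
      forall u hu, punct_rest u = x -> b = punct_val (s u hu)}.
    apply: cid; have [xa|nx] := eqVneq x (p a).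
      exists a; split=> //; split=> // u hu ux.
      by have [_] := punctP u; rewrite ux hu xa eqxx.
    have [u [ua ux]] := punct_exists h nx.
    exists (punct_val (s u ua)); split; first by rewrite sv.
    split=> [xa|v hv vx]; first by rewrite xa eqxx in nx.
    congr (punct_val _); apply: sE.
    by apply: punct_inj; rewrite ?ua ?hv ?ux ?vx.
  exists (fun x h => projT1 (pick x h)); split=> [x h|h|u hu h].
  - by case: (pick x h) => b [].
  - by case: (pick _ h) => b [_ [/= ->]].
  - by case: (pick _ h) => b [_ [_ /= bu]]; apply: bu.
have [t0 [[qt0 t0s] t0u]] := sec (f (p a)) s' s'P.
have [w [[f'w pw] wu]] := pb2 t0 (p a) qt0.
have ew : e w = a.
  have h : f (p (e w)) = f (p a) by rewrite [p (e w)]pw.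
  rewrite (t0s w h f'w); move: h; rewrite [p (e w)]pw => h; exact: s'a.
exists w; split.
  split=> // v hv vw; have [h1 h2] := punct_evE v.
  apply: punct_fibre_inj.
    by rewrite sP.
  have [fu nu] := punctP (punct_base (punct_ev v)).
  have h : f (punct_rest (punct_base (punct_ev v))) = f (p a).
    by rewrite fu hv.
  rewrite -(s'u _ hv h) h2.
  have eV : p (e (gpi1 f' v)) = punct_rest (punct_base (punct_ev v)).
    by rewrite -punct_fibreE h2.
  have h' : f (p (e (gpi1 f' v))) = f (p a) by rewrite eV.
  rewrite (t0s _ h'); last first.
    by rewrite -f'w -vw; case: (v) => ? /= /andP[/eqP].
  move: h'; rewrite eV => h'; congr s'; exact: Prop_irrelevance.
move=> w' [ew' w's].
have t0E : t0 = f' w'.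
  apply: t0u; split=> [|v hv vw']; first by rewrite -fp ew'.
  have [vw|nvw] := eqVneq v w'.
    by subst v; move: hv; rewrite ew' => hv; rewrite s'a.
  have h : (f' (v, w').1 == f' (v, w').2) && ((v, w').1 != (v, w').2).
    by rewrite /= vw' eqxx nvw.
  pose o : goffdiag f' := exist _ (v, w') h.
  have [h1 h2] := punct_evE o.
  have hx : punct_pt (punct_base (punct_ev o)) = a by rewrite [LHS]h1.
  have eo : e v = punct_val (punct_ev o) by rewrite [RHS]h2.
  have := w's o hx erefl => so.
  rewrite [LHS]eo so.
  have pe : p (e v) = punct_rest (punct_base (punct_ev o)).
    by rewrite eo punct_fibreE.
  by move: hv; rewrite pe => hv; rewrite (s'u _ hx).
by apply: wu; rewrite t0E; split=> //=; rewrite ew'.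
Qed.

End PuncturedExponential.

(** * Norms in Tambara functors *)

Lemma exponential_exists (gT : finGroupType) (O : indexing_system gT)
    (X Y E : gset gT) (f : gmap X Y) (p : gmap E X) :
  admissible O f -> exists P X' (e : gmap X' E) (f' : gmap X' P) (q : gmap P Y),
    is_exponential f p e f' q /\ admissible O f'.
Proof.
move=> a; have ex := dprodP f p; have [pb _] := ex.
exists (dprod_set f p), (dprod_ev_set f p), (dprod_ev f p), (dprod_pt f p).
by exists (dprod_base f p); split; last exact: admissible_base_change pb a.
Qed.

Section NormTheory.
Variables (gT : finGroupType) (O : indexing_system gT) (R : tambara O).
Implicit Types X Y Z E P : gset gT.

Lemma tnm_copair X0 X1 Y (f0 : gmap X0 Y) (f1 : gmap X1 Y)
    (a : admissible O (gcopair f0 f1))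
    (a0 : admissible O f0) (a1 : admissible O f1) z :
  tnm R a z =
  tnm R a0 (gres R (ginl X0 X1) z) * tnm R a1 (gres R (ginr X0 X1) z).
Proof.
have as_ := admissible_sum a0 a1.
rewrite (tnm_comp (@admissible_fold _ O Y) as_) tnm_fold.
have pl : is_pullback (ginl Y Y) (gsum f0 f1) f0 (ginl X0 X1).
  by split=> // y [x|x] //= [->]; exists x; split=> // w [_ []].
have pr : is_pullback (ginr Y Y) (gsum f0 f1) f1 (ginr X0 X1).
  by split=> // y [x|x] //= [->]; exists x; split=> // w [_ []].
by rewrite (tnm_dc as_ a0 pl) (tnm_dc as_ a1 pr).
Qed.

(** [X x_Y X] is its off-diagonal part together with the diagonal, a copy of
    [X]. *)
Lemma goffdiag_id_pullback X Y (f : gmap X Y) :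
  is_pullback f f (gcopair (gpi2 f) (gid X)) (gcopair (gpi1 f) (gid X)).
Proof.
split=> [[[[x1 x2] /= /andP[/eqP ->]]|] //|x2 x1 e].
have [xE|n] := eqVneq x1 x2.
  subst x2; exists (inr x1); split=> // -[[[y1 y2] /= h]|y] /= [y2E y1E].
    by case/andP: (h) => _ /eqP[]; rewrite y1E.
  by rewrite y1E.
have h : (f (x1, x2).1 == f (x1, x2).2) && ((x1, x2).1 != (x1, x2).2).
  by rewrite /= e eqxx n.
exists (inl (exist _ (x1, x2) h)); split=> // -[[[y1 y2] /= k]|y] /= [y2E y1E].
  by subst y1 y2; congr inl; apply: val_inj.
by case/eqP: (n); rewrite -y2E.
Qed.

Lemma gres_tnm_self X Y (f : gmap X Y) (a : admissible O f) u :
  gres R f (tnm R a u) = tnm R (admissible_pi2 a) (gres R (gpi1 f) u) * u.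
Proof.
have a2 := admissible_copair (admissible_pi2 a) (@admissible_id _ O X).
rewrite (tnm_dc a a2 (goffdiag_id_pullback f)).
rewrite (tnm_copair a2 (admissible_pi2 a) (@admissible_id _ O X)).
by rewrite -!gres_comp !gcopair_inl !gcopair_inr tnm_id gres_id.
Qed.

(** Zero is a transfer from the empty set, and over nonempty fibres there is no
    section of the empty set: reciprocity gives a transfer from the empty set
    again. *)
Lemma tnm0 X Y (f : gmap X Y) (a : admissible O f) :
  (forall y, exists x, f x = y) -> tnm R a 0 = 0.
Proof.
move=> fS; pose V : gset gT := gset_triv gT void.
have vact Z (t : void -> Z) (x : V) b : t (gact V x b) = gact Z (t x) b.
  by case: x.
pose v Z : gmap V Z := @GMap _ V Z (fun x => match x with end) (vact Z _).
have ex : is_exponential f (v X) (gid V) (gid V) (v Y).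
  split; first by split=> -[].
  move=> y s _; have [x fx] := fS y; by case: (s x fx).
rewrite -(raddf0 (gtr R (v X))) (tnm_tr a (@admissible_id _ O V) ex).
have -> : tnm R (@admissible_id _ O V) (gres R (gid V) 0) = 0.
  by apply: (mk_empty (green_mackeyP R)); case.
by rewrite raddf0.
Qed.

Lemma gpi2_surj X Y (f : gmap X Y) : two_surjective f ->
  forall x, exists w, gpi2 f w = x.
Proof.
move=> f2 x; have := f2 (f x); rewrite (cardD1 x) inE eqxx ltnS.
case/card_gt0P => x' /[!inE] /andP[n /eqP e].
have h : (f (x', x).1 == f (x', x).2) && ((x', x).1 != (x', x).2).
  by rewrite /= e eqxx n.
by exists (exist _ (x', x) h).
Qed.

Lemma two_surjectiveW X Y (f : gmap X Y) : two_surjective f ->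
  forall y, exists x, f x = y.
Proof.
move=> f2 y; have /ltnW /card_gt0P[x] := f2 y.
by rewrite inE => /eqP <-; exists x.
Qed.

(** The fibre of the fold map through a point of one copy of [X] contains only
    one other point, its twin in the other copy. *)
Lemma gres_tnm_punctured_fold X (side other : gmap X (gset_sum X X))
    (c : admissible O (gpi2 (gfold X))) z :
  (forall v, gfold X (side v) = v) -> (forall v, gfold X (other v) = v) ->
  (forall u, u = side (gfold X u) \/ u = other (gfold X u)) ->
  (forall v, other v <> side v) ->
  gres R side (tnm R c (gres R (gpi1 (gfold X)) z)) = gres R other z.
Proof.
move=> sP oP cover dis.
have h v : (gfold X (other v, side v).1 == gfold X (other v, side v).2) &&
    ((other v, side v).1 != (other v, side v).2).
  by apply/andP; split; [rewrite [eqbLHS]oP [eqbRHS]sP | apply/eqP/dis].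
pose k0 v : goffdiag (gfold X) := exist _ (other v, side v) (h v).
have kP v b : k0 (gact X v b) = gact (goffdiag (gfold X)) (k0 v) b.
  by apply: val_inj; congr (_, _); apply: gmapP.
pose k : gmap X (goffdiag (gfold X)) := GMap kP.
have pb : is_pullback side (gpi2 (gfold X)) (gid X) k.
  split=> // v [[u1 u2] hu] e; rewrite /= in e; subst u2.
  exists v; split=> [|v' [] //]; split=> //; apply: val_inj => /=.
  congr (_, _); have /andP[/eqP e n] := hu.
  have {}e : gfold X u1 = v by rewrite -(sP v).
  have [u1E|->] := cover u1; last by rewrite e.
  by case/eqP: n; rewrite [LHS]u1E e.
rewrite (tnm_dc c (@admissible_id _ O X) pb) tnm_id -gres_comp.
by congr (gres _ _ _); apply: gmap_eq.
Qed.

(* *)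
(** The norm of a transfer over punctured fibres: reciprocity for
    [punct_exponential]. *)
Lemma punctured_tnm_gtr X Y E X' P (f : gmap X Y) (p : gmap E X)
    (e : gmap X' E) (f' : gmap X' P) (q : gmap P Y)
    (a : admissible O f) (a' : admissible O f') (u : R E) :
  is_exponential f p e f' q ->
  gres R p (tnm R (admissible_pi2 a) (gres R (gpi1 f) (gtr R p u))) =
  gtr R e (tnm R (admissible_pi2 a') (gres R (gpi1 f') (gres R e u))).
Proof.
move=> ex; have pb := gpbP p (gpi2 f).
have ap := admissible_base_change pb (admissible_pi2 a).
rewrite (tnm_dc _ ap pb) -gres_comp -/(punct_rest f p) -/(punct_pt f p).
rewrite (gtr_dc (gpbP (punct_rest f p) p)).
rewrite (tnm_tr ap (admissible_pi2 a') (punct_exponential ex)).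
by rewrite -!gres_comp -(punct_val_ev ex).
Qed.

End NormTheory.

(** * Norms of sums *)

Section PullbackLift.
Variable gT : finGroupType.
Implicit Types X Y Z P Q : gset gT.

Section Lift.
Variables (X Y Z Q : gset gT) (g : gmap Z Y) (f : gmap X Y).
Variables (u : gmap Q Z) (v : gmap Q X).
Hypothesis uv : forall w, g (u w) = f (v w).
Lemma gpb_lift_subproof w : g (u w, v w).1 == f (u w, v w).2.
Proof. by rewrite /= uv. Qed.
Definition gpb_lift_fun w : gpb g f := exist _ (u w, v w) (gpb_lift_subproof w).
Lemma gpb_lift_act w a :
  gpb_lift_fun (gact Q w a) = gact (gpb g f) (gpb_lift_fun w) a.
Proof. by apply: val_inj; rewrite /= !gmapP. Qed.
Definition gpb_lift : gmap Q (gpb g f) := GMap gpb_lift_act.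
End Lift.

Lemma pullback_paste X Y Z P Q (q : gmap P Y) (f : gmap X Y) (j : gmap Z P)
    (u : gmap Q Z) (v : gmap Q X) (pb : is_pullback (gcomp q j) f u v) :
  is_pullback j (gpb1 q f) u (@gpb_lift _ _ _ _ q f (gcomp j u) v pb.1).
Proof.
have [comm ex] := pb; split=> // z [[t x] tx'] jz; rewrite /= in jz; subst t.
have /eqP /= tx := tx'.
have [w [[uw vw] wu]] := ex z x tx.
exists w; split=> [|w' [uw' e]].
  by split=> //; apply: val_inj; rewrite /= uw vw.
by apply: wu; split=> //; have /= := congr1 (fun v => (val v).2) e.
Qed.

Section Split.
Variables (X Y Z P : gset gT) (g : gmap Z Y) (f : gmap X Y).
Variables (f' : gmap P Z) (g' : gmap P X) (b : pred P).
Hypothesis bact : forall w a, b (gact P w a) = b w.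

Lemma split_pos_subproof w a : b w -> b (gact P w a).
Proof. by rewrite bact. Qed.
Lemma split_neg_subproof w a : ~~ b w -> ~~ b (gact P w a).
Proof. by rewrite bact. Qed.
Definition split_pos := gset_sub split_pos_subproof.
Definition split_neg := gset_sub split_neg_subproof.
Definition pos_incl : gmap split_pos P :=
  @GMap _ split_pos P (fun w => val w) (fun _ _ => erefl).
Definition neg_incl : gmap split_neg P :=
  @GMap _ split_neg P (fun w => val w) (fun _ _ => erefl).

Lemma pullback_split : is_pullback g f f' g' ->
  is_pullback g f (gcopair (gcomp f' neg_incl) (gcomp f' pos_incl))
                  (gcopair (gcomp g' neg_incl) (gcomp g' pos_incl)).
Proof.
case=> comm ex; split=> [[]//=|z x e]; have [w [[wz wx] wu]] := ex z x e.
have [bw|nbw] := boolP (b w).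
  exists (inr (exist _ w bw)); split=> // -[[w' h]|[w' h]] /= [h1 h2].
    by case/negP: (h); rewrite -(wu w').
  by congr inr; apply: val_inj; apply: wu.
exists (inl (exist _ w nbw)); split=> // -[[w' h]|[w' h]] /= [h1 h2].
  by congr inl; apply: val_inj; apply: wu.
by case/negP: nbw; rewrite (wu w').
Qed.
End Split.
End PullbackLift.

Section NormOfSum.
Variables (gT : finGroupType) (O : indexing_system gT) (R : tambara O).
Variables (X Y : gset gT) (f : gmap X Y).

(** A section of the fold map of [X] over a fibre of [f] is a choice of left or
    right at each point, encoded by the subset of the points where the choice
    is right. *)
Definition in_fibre (w : gset_prod Y (gset_pow X)) : bool :=
  [forall x, (x \in (w.2 : {set X})) ==> (f x == w.1)].
Lemma in_fibre_act w a :
  in_fibre w -> in_fibre (gact (gset_prod Y (gset_pow X)) w a).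
Proof.
move=> /forallP h; apply/forallP=> x; apply/implyP.
rewrite mem_gset_powV => xw; have /implyP/(_ xw)/eqP := h (gact X x a^-1%g).
by rewrite gmapP /= => <-; rewrite gactKV.
Qed.
Definition fpow := gset_sub in_fibre_act.
Definition fpow_base : gmap fpow Y :=
  @GMap _ fpow Y (fun t => (val t).1) (fun _ _ => erefl).
Definition fpow_set (t : fpow) : {set X} := (val t).2.

Lemma fpow_setP t x : x \in fpow_set t -> f x = fpow_base t.
Proof. by case: t => -[y S] /= /forallP/(_ x)/implyP h /h/eqP. Qed.
Lemma fpow_set_act t x a :
  (gact X x a \in fpow_set (gact fpow t a)) = (x \in fpow_set t).
Proof. exact: mem_gset_pow. Qed.
Lemma fpow_inj t t' :
  fpow_base t = fpow_base t' -> fpow_set t = fpow_set t' -> t = t'.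
Proof.
case: t t' => -[y S] h [[y' S'] h'] /= e1; rewrite /fpow_set /= => e2.
by apply: val_inj; rewrite /= e1 e2.
Qed.

Definition fpow_pt := gpb fpow_base f.
Definition fpow_ev_fun (w : fpow_pt) : gset_sum X X :=
  if (val w).2 \in fpow_set (val w).1 then inr (val w).2 else inl (val w).2.
Lemma fpow_ev_act w a :
  fpow_ev_fun (gact fpow_pt w a) = gact (gset_sum X X) (fpow_ev_fun w) a.
Proof. by rewrite /fpow_ev_fun fpow_set_act; case: ifP. Qed.
Definition fpow_ev : gmap fpow_pt (gset_sum X X) := GMap fpow_ev_act.

Lemma fold_exponential :
  is_exponential f (gfold X) fpow_ev (gpb1 fpow_base f) fpow_base.
Proof.
split.
  have -> : gcomp (gfold X) fpow_ev = gpb2 fpow_base f; last exact: gpbP.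
  by apply: gmap_eq => w /=; rewrite /fpow_ev_fun; case: ifP.
move=> y s sP.
pose S := [set x | `[< exists h : f x = y, s x h = inr x >]].
have SP x : reflect (exists h : f x = y, s x h = inr x) (x \in S).
  by rewrite inE; apply: asboolP.
have h : in_fibre ((y, S) : gset_prod Y (gset_pow X)).
  by apply/forallP=> x; apply/implyP=> /SP[e _]; rewrite /= e.
have sE x (hx : f x = y) : s x hx = if x \in S then inr x else inl x.
  have := sP x hx; case: SP => [[hx']|nS].
    by rewrite (Prop_irrelevance hx hx').
  case E : (s x hx) => [x'|x'] /= ex; subst x' => //.
  by case: nS; exists hx.
have evE w (hx : f (gfold X (fpow_ev w)) = y) :
    s (gfold X (fpow_ev w)) hx =
    if (val w).2 \in S then inr (val w).2 else inl (val w).2.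
  by rewrite sE /= /fpow_ev_fun; case: (_ \in fpow_set _).
exists (exist _ (y, S) h); split.
  by split=> // w hx ew; rewrite evE /= /fpow_ev_fun; rewrite [(val w).1]ew.
move=> t [ty tS]; apply: fpow_inj => //; apply/setP=> x /=.
rewrite [fpow_set _]/=.
have [fx|nfx] := eqVneq (f x) y; last first.
  have -> : x \in S = false by apply: contra_neqF nfx => /SP[].
  by apply/esym; apply: contra_neqF nfx => /fpow_setP ->.
have k : fpow_base (t, x).1 == f (t, x).2 by rewrite /= fx; apply/eqP.
pose w : fpow_pt := exist _ (t, x) k.
have hx : f (gfold X (fpow_ev w)) = y.
  by rewrite /= /fpow_ev_fun /=; case: ifP.
have := tS w hx erefl; rewrite evE /= /fpow_ev_fun /=.
by case: (x \in S); case: (x \in fpow_set t).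
Qed.

(** [fpow0], [fpow1] and [fpow2] cut the set of subsets of fibres according to
    cardinality: none, one, at least two.  An element of a Mackey functor on
    this set is then the sum of the transfers of its three restrictions. *)
Lemma fpow0_subproof y : in_fibre ((y, set0) : gset_prod Y (gset_pow X)).
Proof. by apply/forallP=> x; rewrite inE. Qed.
Definition fpow0_fun y : fpow := exist _ (y, set0) (fpow0_subproof y).
Lemma fpow0_act y a : fpow0_fun (gact Y y a) = gact fpow (fpow0_fun y) a.
Proof.
by apply: fpow_inj => //; apply/setP=> x; rewrite /fpow_set mem_gset_powV !inE.
Qed.
Definition fpow0 : gmap Y fpow := GMap fpow0_act.

Lemma fpow1_subproof x : in_fibre ((f x, [set x]) : gset_prod Y (gset_pow X)).
Proof. by apply/forallP=> x'; apply/implyP; rewrite inE => /eqP ->. Qed.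
Definition fpow1_fun x : fpow := exist _ (f x, [set x]) (fpow1_subproof x).
Lemma fpow1_act x a : fpow1_fun (gact X x a) = gact fpow (fpow1_fun x) a.
Proof.
apply: fpow_inj; first by rewrite /= gmapP.
apply/setP=> x'; rewrite /fpow_set mem_gset_powV !inE.
by apply/eqP/eqP=> [->|<-]; rewrite ?gactK ?gactKV.
Qed.
Definition fpow1 : gmap X fpow := GMap fpow1_act.

Definition fpow_large (t : fpow) := (2 <= #|fpow_set t|)%N.
Lemma fpow_large_act t a : fpow_large t -> fpow_large (gact fpow t a).
Proof. by rewrite /fpow_large /fpow_set /= card_setact. Qed.
Definition fpow2_set := gset_sub fpow_large_act.
Definition fpow2 : gmap fpow2_set fpow :=
  @GMap _ fpow2_set fpow (fun t => val t) (fun _ _ => erefl).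

Lemma fpow_decomp : bijective (gcopair fpow0 (gcopair fpow1 fpow2)).
Proof.
set k := gcopair _ _.
have kI : injective k.
  have k1 x : fpow_set (fpow1 x) = [set x] by [].
  have k2 u : (2 <= #|fpow_set (fpow2 u)|)%N by case: u.
  move=> [y|[x|u]] [y'|[x'|u']] /=.
  - by case=> ->.
  - by move/(congr1 fpow_set); rewrite k1 => /setP/(_ x'); rewrite !inE eqxx.
  - by move/(congr1 fpow_set) => e; have := k2 u'; rewrite -e cards0.
  - by move/(congr1 fpow_set); rewrite k1 => /setP/(_ x); rewrite !inE eqxx.
  - by move/(congr1 fpow_set)/set1_inj => ->.
  - by move/(congr1 fpow_set) => e; have := k2 u'; rewrite -e cards1.
  - by move/(congr1 fpow_set) => e; have := k2 u; rewrite /= e cards0.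
  - by move/(congr1 fpow_set) => e; have := k2 u; rewrite /= e cards1.
  - by move=> e; congr (inr (inr _)); apply: val_inj.
have kS t : exists w, k w = t.
  have [t2|] := boolP (fpow_large t).
    by exists (inr (inr (exist _ t t2))).
  rewrite /fpow_large -leqNgt leq_eqVlt ltnS leqn0.
  case/orP=> [/cards1P[x tx]|/eqP/cards0_eq t0].
    exists (inr (inl x)); apply: fpow_inj => //.
    by rewrite /= (@fpow_setP t x) // tx inE.
  by exists (inl (fpow_base t)); apply: fpow_inj.
exists (fun t => projT1 (cid (kS t))) => [w|t]; last by case: cid.
by apply: kI; case: cid.
Qed.

Lemma fpow_pullback0 :
  is_pullback fpow0 (gpb1 fpow_base f) f
    (@gpb_lift _ _ _ _ _ fpow_base f (gcomp fpow0 f) (gid X) (fun=> erefl)).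
Proof.
have pb : is_pullback (gcomp fpow_base fpow0) f f (gid X).
  by split=> // y x /= ->; exists x; split=> // w [_ <-].
have := pullback_paste pb; congr is_pullback.
by apply: gmap_eq => w; apply: val_inj.
Qed.

Variables (x i : R X) (a : admissible O f).

(** Over a family [j] of subsets of fibres, the points outside the subset
    contribute a factor [x] and those inside it a factor [i]; they are
    enumerated by [r0] and [r1]. *)
Lemma fpow_part Z Q0 Q1 (j : gmap Z fpow) (g0 : gmap Q0 Z) (g1 : gmap Q1 Z)
    (r0 : gmap Q0 X) (r1 : gmap Q1 X) (z : R (gset_sum X X))
    (a' : admissible O (gpb1 fpow_base f))
    (a0 : admissible O g0) (a1 : admissible O g1) :
  gres R (ginl X X) z = x -> gres R (ginr X X) z = i ->
  is_pullback (gcomp fpow_base j) f (gcopair g0 g1) (gcopair r0 r1) ->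
  (forall v, r0 v \notin fpow_set (j (g0 v))) ->
  (forall v, r1 v \in fpow_set (j (g1 v))) ->
  gres R j (tnm R a' (gres R fpow_ev z)) =
  tnm R a0 (gres R r0 x) * tnm R a1 (gres R r1 i).
Proof.
move=> zx zi pb r0P r1P; have a01 := admissible_copair a0 a1.
rewrite (tnm_dc a' a01 (pullback_paste pb)) (tnm_copair a01 a0 a1).
rewrite -zx -zi -!gres_comp; congr (_ * _); congr (tnm _ _ (gres _ _ _)).
  by apply: gmap_eq => v; rewrite /= /fpow_ev_fun /= (negPf (r0P v)).
by apply: gmap_eq => v; rewrite /= /fpow_ev_fun /= (r1P v).
Qed.

(** The binomial expansion of a norm, to first order: reciprocity for the fold
    map, with the empty subsets giving the first term and the singletons the
    second one.  Over the singletons the complement of the chosen point in its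
    fibre is enumerated by the off-diagonal part of [X x_Y X]. *)
Lemma tnmD_expansion : exists P2 Q0 Q1 (g0 : gmap Q0 P2) (g1 : gmap Q1 P2)
    (r0 : gmap Q0 X) (r1 : gmap Q1 X) (q : gmap P2 Y)
    (a0 : admissible O g0) (a1 : admissible O g1),
  two_surjective g1 /\
  tnm R a (x + i) = tnm R a x
    + gtr R f (tnm R (admissible_pi2 a) (gres R (gpi1 f) x) * i)
    + gtr R q (tnm R a0 (gres R r0 x) * tnm R a1 (gres R r1 i)).
Proof.
have [z [zx zi]] := green_glue x i.
have [pbe _] := fold_exponential.
have a' : admissible O (gpb1 fpow_base f) := admissible_base_change pbe a.
have -> : x + i = gtr R (gfold X) z by rewrite gtr_fold zx zi.
rewrite (tnm_tr a a' fold_exponential).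
set n := tnm R a' _.
pose q2 := gcomp fpow_base fpow2.
pose b (w : gpb q2 f) := (val w).2 \in fpow_set (fpow2 (val w).1).
have bact w c : b (gact (gpb q2 f) w c) = b w by rewrite /b /= fpow_set_act.
have pb2 := pullback_split bact (gpbP q2 f).
set g0 := gcomp (gpb1 q2 f) _ in pb2; set g1 := gcomp (gpb1 q2 f) _ in pb2.
set r0 := gcomp (gpb2 q2 f) _ in pb2; set r1 := gcomp (gpb2 q2 f) _ in pb2.
have aincl Q (u : gmap Q (gpb q2 f)) :
    injective u -> admissible O (gcomp (gpb1 q2 f) u).
  move=> uI.
  apply: (@admissible_pullback _ _ _ _ _ _ q2 f _ (gcomp (gpb2 q2 f) u)) a.
    move=> w w' /= [e1 e2].
    by apply/uI/(pullback_inj (gpbP q2 f)); congr (_, _).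
  by move=> w; have [/(_ (u w))] := gpbP q2 f.
have a0 : admissible O g0 by apply: aincl => w w'; apply: val_inj.
have a1 : admissible O g1 by apply: aincl => w w'; apply: val_inj.
exists fpow2_set, (split_neg bact), (split_pos bact), g0, g1, r0, r1, q2.
exists a0, a1.
split.
  move=> u; have : fpow_large (fpow2 u) by case: u.
  rewrite /fpow_large => /leq_trans; apply.
  apply: leq_trans (leq_imset_card r1 _); apply/subset_leq_card/subsetP=> v uv.
  have h : q2 (u, v).1 == f (u, v).2 by apply/eqP/esym/fpow_setP.
  pose w : gpb q2 f := exist _ (u, v) h.
  have bw : b w by [].
  by apply/imsetP; exists (exist _ w bw); rewrite ?inE.
(* split the transfer along the three strata of subsets *)
rewrite -{1}[n](mtr_mres_bij (M := green_mackey R) n fpow_decomp) /=.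
rewrite !gtr_copair !raddfD /= -!gtr_comp -!gres_comp.
rewrite !gcompA !gcopair_inr !gcopair_inl addrA.
have -> : gres R fpow0 n = tnm R a x.
  rewrite (tnm_dc a' a fpow_pullback0) -gres_comp -zx.
  congr (tnm _ _ (gres _ _ _)); apply: gmap_eq => w.
  by rewrite /= /fpow_ev_fun /= /fpow_set /= inE.
have -> : gcomp fpow_base fpow0 = gid Y by apply: gmap_eq.
have e1 : gcomp fpow_base fpow1 = f by apply: gmap_eq.
have pb1 : is_pullback (gcomp fpow_base fpow1) f
    (gcopair (gpi2 f) (gid X)) (gcopair (gpi1 f) (gid X)).
  by rewrite e1; apply: goffdiag_id_pullback.
rewrite e1 gtr_id; congr (_ + _ + _); congr (gtr _ _ _).
  rewrite (fpow_part a' (admissible_pi2 a) (@admissible_id _ O X) zx zi pb1).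
  - by rewrite tnm_id gres_id.
  - by case=> -[v1 v2] /= /andP[_ n12]; rewrite inE.
  - by move=> v; rewrite inE.
apply: (fpow_part a' a0 a1 zx zi pb2) => -[v vb] //.
Qed.

End NormOfSum.

(** * Quotients of Tambara functors *)

(** The hypotheses say that congruence modulo [J] respects products and norms.
    Every operation is then induced on the quotient, and all the axioms hold
    there because they hold for representatives. *)
Section NormQuotient.
Variables (gT : finGroupType) (O : indexing_system gT) (R : tambara O).
Variable J : submackey (green_mackey R).
Implicit Types X Y Z E P : gset gT.
Hypothesis J_mul : forall X (r x : R X), J X x -> J X (r * x).
Hypothesis J_nm : forall X Y (f : gmap X Y) (a : admissible O f) (x y : R X),
  J X (x - y) -> J Y (tnm R a x - tnm R a y).

Section Ring.
Variable X : gset gT.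
Notation Q := (quot_car J X).
Notation pi := (quot_pi J X).
Definition quot_mul (q r : Q) : Q :=
  pi ((generic_quotient.repr q : R X) * generic_quotient.repr r).
Lemma quot_mulE (x y : R X) : quot_mul (pi x) (pi y) = pi (x * y : R X).
Proof.
rewrite /quot_mul; set x' := generic_quotient.repr _.
set y' := generic_quotient.repr _.
have xx : J X (x' - x) by apply/quot_piP; rewrite [LHS]reprK.
have yy : J X (y' - y) by apply/quot_piP; rewrite [LHS]reprK.
apply/quot_piP.
have -> : (x' : R X) * y' - x * y =
    y' * ((x' : R X) - x) + x * ((y' : R X) - y).
  by rewrite !mulrBr addrA [y' * x]mulrC [y' * x']mulrC subrK.
by apply: smD; apply: J_mul.
Qed.
Lemma quot_mulA : associative quot_mul.
Proof.
move=> q r s; have [x <-] := quot_pi_surj q; have [y <-] := quot_pi_surj r.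
by have [z <-] := quot_pi_surj s; rewrite !quot_mulE mulrA.
Qed.
Lemma quot_mulC : commutative quot_mul.
Proof.
move=> q r; have [x <-] := quot_pi_surj q; have [y <-] := quot_pi_surj r.
by rewrite !quot_mulE mulrC.
Qed.
Lemma quot_mul1 : left_id (pi (1 : R X)) quot_mul.
Proof. by move=> q; have [x <-] := quot_pi_surj q; rewrite quot_mulE mul1r. Qed.
Lemma quot_mulDl : left_distributive quot_mul +%R.
Proof.
move=> q r s; have [x <-] := quot_pi_surj q; have [y <-] := quot_pi_surj r.
by have [z <-] := quot_pi_surj s; rewrite -raddfD !quot_mulE mulrDl raddfD.
Qed.
Definition quot_ring : comPzRingType :=
  HB.pack (Q : Type) (GRing.Zmodule.on Q)
    (GRing.Zmodule_isComPzRing.Build Q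
      quot_mulA quot_mulC quot_mul1 quot_mulDl).
Lemma quot_pi_multiplicative :
  GRing.monoid_morphism (pi : R X -> quot_ring).
Proof. by split=> [|x y] //; apply: (esym (quot_mulE x y)). Qed.
Definition quot_pi_ring : {rmorphism R X -> quot_ring} :=
  HB.pack (pi : R X -> quot_ring)
    (GRing.isZmodMorphism.Build (R X) quot_ring pi (raddfB pi))
    (GRing.isMonoidMorphism.Build (R X) quot_ring pi quot_pi_multiplicative).
End Ring.

Definition quot_gres X Y (f : gmap X Y) : quot_ring Y -> quot_ring X :=
  quot_res J f.
Lemma quot_gresE X Y (f : gmap X Y) (y : R Y) :
  quot_gres f (quot_pi_ring Y y) = quot_pi_ring X (gres R f y).
Proof. exact: (quot_resE J f). Qed.
Lemma quot_ring_surj X (q : quot_ring X) : exists x, quot_pi_ring X x = q.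
Proof. exact: (quot_pi_surj (q : quot_car J X)). Qed.
Lemma quot_gres_additive X Y (f : gmap X Y) : zmod_morphism (quot_gres f).
Proof. by move=> x y; apply: (raddfB (quot_res J f)). Qed.
Lemma quot_gres_multiplicative X Y (f : gmap X Y) :
  GRing.monoid_morphism (quot_gres f).
Proof.
split=> [|q r].
  by rewrite -(rmorph1 (quot_pi_ring Y)) quot_gresE !rmorph1.
have [x <-] := quot_ring_surj q; have [y <-] := quot_ring_surj r.
by rewrite -rmorphM !quot_gresE !rmorphM.
Qed.
Definition quot_gres_morph X Y (f : gmap X Y) :
    {rmorphism quot_ring Y -> quot_ring X} :=
  HB.pack (quot_gres f)
    (GRing.isZmodMorphism.Build (quot_ring Y) (quot_ring X) _
      (quot_gres_additive f))
    (GRing.isMonoidMorphism.Build (quot_ring Y) (quot_ring X) _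
      (quot_gres_multiplicative f)).
Definition quot_gtr X Y (f : gmap X Y) :
    {additive quot_ring X -> quot_ring Y} :=
  quot_tr J f.
Lemma quot_gtrE X Y (f : gmap X Y) (y : R X) :
  quot_gtr f (quot_pi_ring X y) = quot_pi_ring Y (gtr R f y).
Proof. exact: (quot_trE J f). Qed.

Lemma quot_green_mackey : is_mackey (M := fun X => quot_ring X)
  (fun X Y f => quot_gres_morph f) quot_gtr.
Proof. by case: (quot_is_mackey J). Qed.
Lemma quot_green_frob X Y (f : gmap X Y) x y :
  quot_gtr f (quot_gres_morph f y * x) = y * quot_gtr f x.
Proof.
have [r <-] := quot_ring_surj x; have [s <-] := quot_ring_surj y.
rewrite [quot_gres_morph f _]quot_gresE -rmorphM !quot_gtrE.
by rewrite green_frob rmorphM.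
Qed.
Definition quot_green : green gT := Green quot_green_mackey quot_green_frob.

Definition quot_nm X Y (f : gmap X Y) (a : admissible O f) (q : quot_green X) :
    quot_green Y :=
  quot_pi_ring Y (tnm R a (projT1 (cid (quot_ring_surj q)))).
Lemma quot_nmE X Y (f : gmap X Y) (a : admissible O f) x :
  quot_nm a (quot_pi_ring X x) = quot_pi_ring Y (tnm R a x).
Proof.
rewrite /quot_nm; case: cid => x' /= /quot_piP xx'.
by apply/quot_piP/J_nm.
Qed.

Definition quot_tambara : tambara O.
Proof.
apply: (@Tambara _ _ quot_green quot_nm).
- by move=> X a q; have [x <-] := quot_ring_surj q; rewrite quot_nmE tnm_id.
- move=> X Y Z g f ag af agf q; have [x <-] := quot_ring_surj q.
  by rewrite !quot_nmE (tnm_comp ag af).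
- by move=> X Y f a; rewrite -(rmorph1 (quot_pi_ring X)) quot_nmE tnm1 rmorph1.
- move=> X Y f a q r; have [x <-] := quot_ring_surj q.
  by have [y <-] := quot_ring_surj r; rewrite -rmorphM !quot_nmE tnmM rmorphM.
- move=> X a q; have [x <-] := quot_ring_surj q.
  by rewrite quot_nmE tnm_fold rmorphM -!quot_gresE.
- move=> X Y Z P g f f' g' a a' pb q; have [x <-] := quot_ring_surj q.
  rewrite quot_nmE [LHS]quot_gresE (tnm_dc a a' pb) -quot_nmE.
  by congr (quot_nm _ _); rewrite -quot_gresE.
move=> X Y E X' P f p e f' q a a' ex r; have [x <-] := quot_ring_surj r.
rewrite [gtr _ _ _]quot_gtrE quot_nmE (tnm_tr a a' ex).
rewrite -[LHS]quot_gtrE -quot_nmE.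
by congr (quot_gtr _ (quot_nm _ _)); rewrite -quot_gresE.
Defined.

Lemma norm_congruence_ideal : is_ideal (fun X => J X : R X -> Prop).
Proof.
exists quot_tambara, (@TambaraMap _ _ R quot_tambara quot_pi_ring
  (fun _ _ f x => esym (quot_gresE f x)) (fun _ _ f x => esym (quot_gtrE f x))
  (fun _ _ f a x => esym (quot_nmE a x))).
move=> X x; rewrite /= -[X in _ = X](raddf0 (quot_pi_ring X)).
split=> [Jx|/quot_piP]; first by apply/quot_piP; rewrite subr0.
by rewrite subr0.
Qed.

End NormQuotient.

(** * The universal derivation *)

Section Universal.
Variables (gT : finGroupType) (O : indexing_system gT).
Variables (A B : tambara O) (phi : tambara_map A B) (C : relbox phi phi).
Implicit Types X Y Z E : gset gT.

Lemma kaehler_pi_eq X (i j : sub_car (aug C) X) :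
  aug_gt1_ideal (val i - val j : C X) ->
  quot_pi (aug_gt1 C) X i = quot_pi (aug_gt1 C) X j.
Proof. by move=> h; apply/quot_piP => J idJ gen; rewrite raddfB; apply: h. Qed.

Lemma delta_is_derivation : is_derivation phi (delta C).
Proof.
split=> [X a|X Y f a s].
  rewrite /= /delta_fun -[RHS](raddf0 (quot_pi (aug_gt1 C) X)).
  congr (quot_pi _ _ _); apply: val_inj.
  by rewrite /= rb_comm subrr.
rewrite [RHS]/= -[_ *: _]/(kaehler_scale _ _) kaehler_scaleE.
rewrite [RHS](quot_trE (aug_gt1 C) f).
apply: kaehler_pi_eq; rewrite /= => J idJ gen.
set i := rb2 C X s - rb1 C X s.
have iI : aug C X i by apply: delta_subproof.
have -> : rb2 C Y (tnm B a s) = tnm C a (rb1 C X s + i).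
  by rewrite tmap_nm /i addrC subrK.
have [P2 [Q0 [Q1 [g0 [g1 [r0 [r1 [q [a0 [a1 [g1_2 ->]]]]]]]]]]] :=
  tnmD_expansion (rb1 C X s) i a.
set n := tnm C a _; set t := gtr C q _.
rewrite !tmap_nm tmap_res -/n -addrA -opprD [_ + t]addrC addrK.
apply: (ideal_tr idJ); apply: (idealM idJ); apply: gen g1_2 _.
exact: (sm_res (s := aug C)).
Qed.

Lemma hom_delta_is_derivation (W : gmodule B) (h : gmod_hom (kaehler C) W) :
  is_derivation phi (mcomp h (delta C)).
Proof.
have [d0 dN] := delta_is_derivation; split=> [X a|X Y f a s].
  by rewrite [LHS]/= [X in h _ X](d0 X a) raddf0.
rewrite [LHS]/= [X in h _ X](dN X Y f a s) [LHS](mmap_tr h).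
by rewrite [X in mtr _ _ X]hom_linear.
Qed.

(** The elements of this form are closed under differences, by transferring
    from a disjoint union; under restriction, by base change; and under
    transfer.  By [rb_ind] they exhaust the box product. *)
Lemma relbox_transferP X (c : C X) : exists E (p : gmap E X) b b',
  c = gtr C p (rb1 C E b * rb2 C E b').
Proof.
pose P X (c : C X) := exists E (p : gmap E X) b b',
  c = gtr C p (rb1 C E b * rb2 C E b').
have [S SE] : exists S : submackey (green_mackey C),
    forall Z c, S Z c <-> P Z c.
  suff [S0 SB Sres Str] : [/\ forall Z, P Z 0,
      forall Z x y, P Z x -> P Z y -> P Z (x - y),
      forall Y Z (f : gmap Y Z) y, P Z y -> P Y (gres C f y) &
      forall Y Z (f : gmap Y Z) x, P Y x -> P Z (gtr C f x)].
    by exists (@SubMackey _ (green_mackey C) P S0 SB Sres Str).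
  split=> [Z|Z x y|Y Z f y|Y Z f x].
  - by exists Z, (gid Z), 0, 0; rewrite rmorph0 mul0r raddf0.
  - move=> [E1 [p1 [b1 [c1 ->]]]] [E2 [p2 [b2 [c2 ->]]]].
    have [b [bl br]] := green_glue b1 (- b2).
    have [c' [cl cr]] := green_glue c1 c2.
    exists (gset_sum E1 E2), (gcopair p1 p2), b, c'.
    rewrite gtr_copair !rmorphM -!tmap_res bl br cl cr.
    by rewrite rmorphN mulNr raddfN.
  - move=> [E [p [b [b' ->]]]]; exists (gpb f p), (gpb1 f p).
    exists (gres B (gpb2 f p) b), (gres B (gpb2 f p) b').
    by rewrite (gtr_dc (gpbP f p)) rmorphM -!tmap_res.
  move=> [E [p [b [b' ->]]]]; exists E, (gcomp f p), b, b'.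
  by rewrite gtr_comp.
apply/SE; apply: rb_ind => Z b b'; apply/SE; exists Z, (gid Z), b, b'.
by rewrite gtr_id.
Qed.

Lemma codiag_tr X Y (f : gmap X Y) (c : C X) :
  codiag C Y (gtr C f c) = gtr B f (codiag C X c).
Proof. exact: (mmap_tr (codiag C)). Qed.

(** Write the element as T_p (b [x] b').  Its image T_p (b b') under the
    codiagonal is zero, so subtracting T_p (b b' [x] 1) changes nothing. *)
Lemma aug_transferP X (c : C X) : aug C X c ->
  exists E (p : gmap E X) b b',
    c = gtr C p (rb1 C E b * (rb2 C E b' - rb1 C E b')).
Proof.
have [E [p [b [b' ->]]]] := relbox_transferP c.
rewrite /aug /= codiag_tr codiagE => bb'; exists E, p, b, b'.
by rewrite mulrBr raddfB -rmorphM -[X in _ - X]tmap_tr bb' rmorph0 subr0.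
Qed.

Lemma kaehler_ext (W : gmodule B) (h k : gmod_hom (kaehler C) W) :
  (forall X b, h X (delta C X b) = k X (delta C X b)) ->
  forall X w, h X w = k X w.
Proof.
move=> hk X w; have [i <-] := quot_pi_surj (w : quot_car (aug_gt1 C) X).
have [E [p [b [b' iE]]]] := aug_transferP (sub_out i).
have -> : quot_pi (aug_gt1 C) X i = wtr (kaehler C) p (b *: delta C E b').
  rewrite -[_ *: _]/(kaehler_scale _ _) kaehler_scaleE.
  rewrite [RHS](quot_trE (aug_gt1 C) p).
  by congr (quot_pi _ _ _); apply: val_inj.
rewrite [LHS](mmap_tr h) [RHS](mmap_tr k).
by congr (mtr _ _ _); rewrite !hom_linear hk.
Qed.

End Universal.

(** * Derivations factor through the differentials *)

Section FromDerivation.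
Variables (gT : finGroupType) (O : indexing_system gT).
Variables (A B : tambara O) (phi : tambara_map A B) (C : relbox phi phi).
Variables (W : gmodule B) (d : der phi W).
Implicit Types X Y Z E : gset gT.

Lemma der_res X Y (f : gmap X Y) b : d X (gres B f b) = wres W f (d Y b).
Proof. exact: (mmap_res d). Qed.
Lemma der_tr X Y (f : gmap X Y) b : d Y (gtr B f b) = wtr W f (d X b).
Proof. exact: (mmap_tr d). Qed.
Lemma der_nm X Y (f : gmap X Y) (a : admissible O f) s :
  d Y (tnm B a s) =
  wtr W f (tnm B (admissible_pi2 a) (gres B (gpi1 f) s) *: (d X s : W X)).
Proof. by have [_] := derP d; apply. Qed.

(** Products are norms along fold maps, and the derivation formula for a fold
    map multiplies the derivative at each point by the value at its twin. *)
Lemma derM X (x y : B X) :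
  d X (x * y) = x *: (d X y : W X) + y *: (d X x : W X).
Proof.
have [z [zx zy]] := green_glue x y.
have a := @admissible_fold _ O X.
have -> : x * y = tnm B a z by rewrite tnm_fold zx zy.
rewrite der_nm wtr_fold !wresZ -!der_res zx zy addrC.
have -> // := gres_tnm_punctured_fold (side := ginr X X) (other := ginl X X);
  last by case; [right | left].
have -> // := gres_tnm_punctured_fold (side := ginl X X) (other := ginr X X);
  last by case; [left | right].
by rewrite zx zy.
Qed.

Definition der_pairing : dress_pairing phi phi (module_mackey W).
Proof.
apply: (@DressPairing _ _ _ _ _ _ _ (module_mackey W)
  (fun X b b' => b *: (d X b' : W X))).
- by move=> X x y z; rewrite scalerDl.
- by move=> X x y z; rewrite raddfD scalerDr.
- by move=> X Y f x y; rewrite /= wresZ der_res.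
- by move=> X Y f x y; rewrite /= der_res wfrob_tr.
- by move=> X Y f x y; rewrite /= wfrob der_tr.
move=> X a x y; have [d0 _] := derP d.
by rewrite derM d0 scaler0 addr0 scalerA.
Defined.

Definition der_ext : mackey_map (green_mackey C) (module_mackey W) :=
  projT1 (cid (rb_univ C der_pairing)).
Lemma der_extE X b b' :
  der_ext X (rb1 C X b * rb2 C X b') = b *: (d X b' : W X).
Proof. by rewrite /der_ext; case: cid => h [hP _] /=; rewrite hP. Qed.
Lemma der_ext_tr X Y (f : gmap X Y) c :
  der_ext Y (gtr C f c) = wtr W f (der_ext X c).
Proof. exact: (mmap_tr der_ext). Qed.

Lemma der_ext_mull X b c : der_ext X (rb1 C X b * c) = b *: (der_ext X c : W X).
Proof.
have [E [p [b1 [b2 ->]]]] := relbox_transferP c.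
rewrite -green_frob -tmap_res mulrA -rmorphM !der_ext_tr !der_extE.
by rewrite -scalerA wfrob.
Qed.

Lemma codiag_mulr X b c : codiag C X (rb2 C X b * c) = b * codiag C X c.
Proof.
have [E [p [b1 [b2 ->]]]] := relbox_transferP c.
rewrite -green_frob -tmap_res mulrCA -rmorphM !codiag_tr !codiagE.
by rewrite mulrCA green_frob.
Qed.

Lemma der_ext_mulr X b c : der_ext X (rb2 C X b * c) =
  b *: (der_ext X c : W X) + codiag C X c *: (d X b : W X).
Proof.
have [E [p [b1 [b2 ->]]]] := relbox_transferP c.
rewrite -green_frob -tmap_res mulrCA -rmorphM !der_ext_tr !der_extE.
rewrite codiag_tr codiagE -wfrob -wfrob_tr -raddfD; congr (wtr _ _ _).
by rewrite derM der_res scalerDr !scalerA [_ * b1]mulrC.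
Qed.

Lemma codiag_nm X Y (f : gmap X Y) (a : admissible O f) c :
  codiag C Y (tnm C a c) = tnm B a (codiag C X c).
Proof.
have [E [p [b1 [b2 ->]]]] := relbox_transferP c.
have [P [X' [e [f' [q [ex a']]]]]] := exponential_exists p a.
rewrite (tnm_tr a a' ex) rmorphM tnmM -!tmap_res -!tmap_nm !codiag_tr !codiagE.
by rewrite (tnm_tr a a' ex) rmorphM tnmM.
Qed.

(** This is the norm of the square-zero extension of [B] by [W].  Write the
    argument as T_p (b [x] b'), with exponential diagram (e, f', q) for f and p.
    The derivation formula along f' turns the left-hand side into a transfer
    along q o f' = f o p o e of N_pi2 R_pi1 R_e (b b') . R_e (b . d b'), with
    pi1 and pi2 the projections for f'; transferring along e alone, the first
    factor becomes the restriction along p of N_pi2 R_pi1 T_p (b b'), for the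
    projections of f, by [punctured_tnm_gtr]. *)
Lemma der_ext_nm X Y (f : gmap X Y) (a : admissible O f) c :
  der_ext Y (tnm C a c) =
  wtr W f (tnm B (admissible_pi2 a) (gres B (gpi1 f) (codiag C X c))
             *: (der_ext X c : W X)).
Proof.
have [E [p [b1 [b2 ->]]]] := relbox_transferP c.
have [P [X' [e [f' [q [ex a']]]]]] := exponential_exists p a.
rewrite (tnm_tr a a' ex) rmorphM tnmM -!tmap_res -!tmap_nm.
rewrite !der_ext_tr !der_extE.
rewrite codiag_tr codiagE der_nm der_res -wfrob gres_tnm_self -wfrob.
rewrite (punctured_tnm_gtr a a' _ ex) -wfrob_tr -!wtr_comp.
have [[comm _] _] := ex.
have -> : gcomp q f' = gcomp f (gcomp p e) by apply: gmap_eq => w; apply: comm.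
rewrite -!gcompA; congr (wtr _ _ _).
by rewrite wresZ !scalerA !rmorphM tnmM; congr (_ *: _); rewrite mulrAC.
Qed.

(** The kernel of the map to the square-zero extension of [B] by [W]. *)
Definition der_ext_kernel : submackey (green_mackey C).
Proof.
apply: (@SubMackey _ (green_mackey C)
  (fun X c => codiag C X c = 0 /\ der_ext X c = 0)).
- by move=> X; rewrite !raddf0.
- by move=> X x y [x0 x1] [y0 y1]; rewrite !raddfB x0 x1 y0 y1 !subrr.
- by move=> X Y f y [y0 y1]; rewrite !mmap_res y0 y1 !raddf0.
- by move=> X Y f x [x0 x1]; rewrite !mmap_tr x0 x1 !raddf0.
Defined.

Lemma der_ext_kernelM X (r x : C X) :
  der_ext_kernel X x -> der_ext_kernel X (r * x).
Proof.
move=> kx; have [E [p [b [b' ->]]]] := relbox_transferP r.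
rewrite mulrC -green_frob; apply: (sm_tr (s := der_ext_kernel)).
have [y0 y1] : der_ext_kernel E (gres C p x).
  exact: (sm_res (s := der_ext_kernel)).
rewrite mulrC -mulrA; split.
  by rewrite codiag_mull codiag_mulr y0 !mulr0.
by rewrite der_ext_mull der_ext_mulr y0 y1 scaler0 scale0r addr0 scaler0.
Qed.

Lemma der_ext_kernel_nm X Y (f : gmap X Y) (a : admissible O f) (x y : C X) :
  der_ext_kernel X (x - y) -> der_ext_kernel Y (tnm C a x - tnm C a y).
Proof.
rewrite /der_ext_kernel /= !raddfB => -[/subr0_eq e0 /subr0_eq e1].
by rewrite !codiag_nm !der_ext_nm e0 e1 !subrr.
Qed.

(** Both components of the norm of an element of [I] along a 2-surjective [f]
    contain the norm of zero along a surjective map: [f] itself, or [pi2]. *)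
Lemma aug_gt1_der_ext X (c : C X) : aug_gt1_ideal c -> der_ext X c = 0.
Proof.
move=> /(_ _ (norm_congruence_ideal der_ext_kernelM der_ext_kernel_nm)) [] //.
move=> Y Z f a i f2 iI; split.
  by rewrite codiag_nm [codiag C Y i]iI tnm0 //; apply: two_surjectiveW.
rewrite der_ext_nm [codiag C Y i]iI rmorph0 tnm0 ?scale0r ?raddf0 //.
exact: gpi2_surj.
Qed.

Definition kaehler_desc_fun X (q : kaehler C X) : W X :=
  der_ext X (val (generic_quotient.repr (q : quot_car (aug_gt1 C) X))).
Lemma kaehler_descE X (i : sub_car (aug C) X) :
  kaehler_desc_fun (quot_pi (aug_gt1 C) X i) = der_ext X (val i).
Proof.
apply/subr0_eq; rewrite /kaehler_desc_fun -raddfB; apply: aug_gt1_der_ext.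
set j := generic_quotient.repr _.
have : aug_gt1 C X (j - i) by apply/quot_piP; rewrite [LHS]reprK.
by move=> ji J idJ gen; have := ji J idJ gen; rewrite raddfB.
Qed.
Lemma kaehler_desc_additive X : zmod_morphism (@kaehler_desc_fun X).
Proof.
move=> q r; have [i <-] := quot_pi_surj (q : quot_car (aug_gt1 C) X).
have [j <-] := quot_pi_surj (r : quot_car (aug_gt1 C) X).
by rewrite -[_ - _](raddfB (quot_pi (aug_gt1 C) X)) !kaehler_descE !raddfB.
Qed.
Lemma kaehler_desc_res X Y (f : gmap X Y) q :
  kaehler_desc_fun (wres (kaehler C) f q) = wres W f (kaehler_desc_fun q).
Proof.
have [i <-] := quot_pi_surj (q : quot_car (aug_gt1 C) Y).
rewrite [X in kaehler_desc_fun X](quot_resE (aug_gt1 C) f) !kaehler_descE.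
exact: (mmap_res der_ext).
Qed.
Lemma kaehler_desc_tr X Y (f : gmap X Y) q :
  kaehler_desc_fun (wtr (kaehler C) f q) = wtr W f (kaehler_desc_fun q).
Proof.
have [i <-] := quot_pi_surj (q : quot_car (aug_gt1 C) X).
rewrite [X in kaehler_desc_fun X](quot_trE (aug_gt1 C) f) !kaehler_descE.
exact: (mmap_tr der_ext).
Qed.
Definition kaehler_desc_map :
    mackey_map (module_mackey (kaehler C)) (module_mackey W) :=
  @MackeyMap gT (module_mackey (kaehler C)) (module_mackey W)
    (fun X => mk_additive (@kaehler_desc_additive X))
    kaehler_desc_res kaehler_desc_tr.
Lemma kaehler_desc_linear : is_linear kaehler_desc_map.
Proof.
move=> X r q; have [i <-] := quot_pi_surj (q : quot_car (aug_gt1 C) X).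
rewrite -[_ *: _ in LHS]/(kaehler_scale _ _) kaehler_scaleE /=.
by rewrite !kaehler_descE /= der_ext_mull.
Qed.
Definition kaehler_desc : gmod_hom (kaehler C) W := GModHom kaehler_desc_linear.

Lemma kaehler_desc_delta X b : kaehler_desc X (delta C X b) = d X b.
Proof.
rewrite /= /delta_fun kaehler_descE /= raddfB.
rewrite -[rb2 C X b]mul1r -(rmorph1 (rb1 C X)) der_extE scale1r.
rewrite -[rb1 C X b]mulr1 -(rmorph1 (rb2 C X)) der_extE.
have [d0 _] := derP d.
by rewrite -(rmorph1 (phi X)) d0 scaler0 subr0.
Qed.

End FromDerivation.

Theorem proposition3p3p2 (gT : finGroupType) (O : indexing_system gT)
    (A B : tambara O) (phi : tambara_map A B) (C : relbox phi phi)
    (W : gmodule B) :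
  (forall h : gmod_hom (kaehler C) W,
     is_derivation phi (mcomp h (delta C))) /\
  exists Psi : gmod_hom (kaehler C) W -> der phi W,
    [/\ (forall h, der_map (Psi h) = mcomp h (delta C)),
        bijective Psi &
        (forall h k, Psi (hom_add h k) = der_add (Psi h) (Psi k))].
Proof.
have der_eq (d e : der phi W) : (forall X b, d X b = e X b) -> d = e.
  case: d e => [d dP] [e eP] /= /(@mackey_map_eq _ _ _ d e) de; subst e.
  by rewrite (Prop_irrelevance dP eP).
have hom_eq (h k : gmod_hom (kaehler C) W) :
    (forall X w, h X w = k X w) -> h = k.
  case: h k => [h hP] [k kP] /= /(@mackey_map_eq _ _ _ h k) hk; subst k.
  by rewrite (Prop_irrelevance hP kP).
split=> [h|]; first exact: hom_delta_is_derivation.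
exists (fun h => Der (hom_delta_is_derivation h)); split=> //.
  exists (@kaehler_desc _ _ _ _ _ C W) => [h|d].
    by apply/hom_eq/kaehler_ext => X b; rewrite kaehler_desc_delta.
  by apply: der_eq => X b; apply: kaehler_desc_delta.
by move=> h k; apply: der_eq.
Qed.
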